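(* Let $k$ be $\mathbb{R}$ or $\mathbb{C}$ and let $\mathfrak{g}$ be a finite-dimensional Lie algebra over $k$. Let $\mathcal{L}=(L,d_{\mathfrak{g}},0)$ be the dgla with $L^i=\bigwedge^{i+1}\mathfrak{g}^\vee\otimes\mathfrak{a}\cong\bigwedge^{i+1}\mathfrak{g}^\vee$, where $\mathfrak{a}$ is the one-dimensional abelian Lie algebra, with Chevalley–Eilenberg differential $d_{\mathfrak{g}}$ and trivial Lie bracket; let $\mathcal{B}=(\bigwedge^\bullet\mathfrak{g},\wedge)$; and let $(\cdot,\cdot)$ be the natural pairing of $\bigwedge^n\mathfrak{g}^\vee$ with $\bigwedge^n\mathfrak{g}$. Then the triple $(\mathcal{L},\mathcal{B},(\cdot,\cdot))$ defines a Maurer–Cartan–Poisson (MCP) structure on the space $\mathrm{MC}(\mathcal{L})=Z^2(\mathfrak{g})=\ker d_{\mathfrak{g}}\cap\bigwedge^2\mathfrak{g}^\vee$ of one-dimensional central extensions of $\mathfrak{g}$.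
   Context: The differential is $(d_{\mathfrak{g}}X)(\alpha_1,\ldots,\alpha_{n+1})=\sum_{i<j}(-1)^{i+j}X([\alpha_i,\alpha_j],\alpha_1,\ldots,\hat\alpha_i,\ldots,\hat\alpha_j,\ldots,\alpha_{n+1})$. For a dgla $\mathcal{L}=(L,d,[\cdot,\cdot])$, $\mathrm{MC}(\mathcal{L})=\{X\in L^1: dX+\frac12[X,X]=0\}$, and $d_X=d+[X,\cdot]$. A BV algebra $(B,\delta,\wedge)$ is a graded vector space with an associative graded commutative product $\wedge:B^i\times B^j\to B^{i+j}$ and a differential $\delta:B^i\to B^{i-1}$, $\delta^2=0$, such that $[a,b]_{\mathcal{B}}=(-1)^{|a|}(\delta(a\wedge b)-\delta a\wedge b-(-1)^{|a|}a\wedge\delta b)$ is a graded Lie bracket (with degrees shifted by one), and $\delta$ is of order two: $\delta(a\wedge b\wedge c)-\delta(a\wedge b)\wedge c+\delta a\wedge b\wedge c-(-1)^{|a|}a\wedge\delta(b\wedge c)-(-1)^{(|a|+1)|b|}b\wedge\delta(a\wedge c)+(-1)^{|a|}a\wedge\delta b\wedge c+(-1)^{|a|+|b|}a\wedge b\wedge\delta c=0.$ An MCP structure with base dgla $\mathcal{L}$ is a triple $(\mathcal{L},\mathcal{B},(\cdot,\cdot))$ of a dgla $\mathcal{L}$, a graded commutative algebra $\mathcal{B}=(B,\wedge)$ and non-degenerate bilinear pairings $(\cdot,\cdot):L^i\times B^{i+1}\to k$ such that for each $X\in\mathrm{MC}(\mathcal{L})$: (1) $d_XX=0$; (2) the map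 $\delta_X:B^i\to B^{i-1}$ defined by $(d_X\,\cdot,\cdot)=(\cdot,\delta_X\,\cdot)$ makes $\mathcal{B}_X=(B,\delta_X,\wedge)$ a BV algebra; (3) there is $k_X\in k$ such that the linear map $\rho_X:B^1\to L^0$ defined by $(X,a\wedge b)=(\rho_Xa,b)$ satisfies $[\rho_Xa,\rho_Xb]=k_X\rho_X[a,b]_{\mathcal{B}_X}$ for all $a,b\in B^1$. *)

(* Defs.v *)
From HB Require Import structures.
From mathcomp Require Import all_boot all_order all_algebra.
From mathcomp Require Import complex.
From mathcomp Require Import all_classical all_reals.

Set Implicit Arguments.
Unset Strict Implicit.
Unset Printing Implicit Defensive.

Import Order.TTheory GRing.Theory Num.Theory.
Local Open Scope classical_set_scope.
Local Open Scope ring_scope.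
Local Open Scope quotient_scope.

Variant real_or_complex : fieldType -> Prop :=
| ROC_real (R : realType) : real_or_complex R
| ROC_complex (R : realType) : real_or_complex (complex R).

Record graded_space (K : fieldType) := GradedSpace {
  gr_carrier :> lmodType K;
  deg : int -> set gr_carrier }.
Arguments deg {K} V i _ : rename.

(* The carrier is the direct sum of the subspaces deg V i, i in int; all the
   structures below use such internal gradings, so that no transport between
   degrees is needed. *)
Record is_graded (K : fieldType) (V : graded_space K) : Prop := IsGraded {
  deg_zero : forall i, deg V i 0;
  deg_linear : forall i (c : K) (x y : V),
    deg V i x -> deg V i y -> deg V i (c *: x + y);
  deg_decomposition : forall x : V, exists! f : int -> V,
    [/\ forall i, deg V i (f i),
        finite_set [set i | f i != 0] &
        x = \sum_(i \in [set: int]) f i] }.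

(* br i is the bracket [x, y] for x homogeneous of degree i: the bracket of a
   BV algebra is given by a formula that involves the degree of its first
   argument. *)
Record is_graded_lie (K : fieldType) (V : lmodType K) (deg : int -> set V)
    (br : int -> V -> V -> V) : Prop := IsGradedLie {
  glie_bilinear : forall i, bilinear_for *:%R *:%R (br i);
  glie_deg : forall i j x y, deg i x -> deg j y -> deg (i + j) (br i x y);
  glie_antisym : forall i j x y, deg i x -> deg j y ->
    br i x y = - ((-1 : K) ^ (i * j) *: br j y x);
  glie_jacobi : forall i j l x y z, deg i x -> deg j y -> deg l z ->
    br i x (br j y z) =
      br (i + j) (br i x y) z + (-1 : K) ^ (i * j) *: br j y (br i x z) }.

Record dgla_data (K : fieldType) := DglaData {
  dgla_space :> graded_space K;
  dgla_d : dgla_space -> dgla_space;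
  dgla_br : dgla_space -> dgla_space -> dgla_space }.
Arguments dgla_d {K L} x : rename.
Arguments dgla_br {K L} x y : rename.

Record is_dgla (K : fieldType) (L : dgla_data K) : Prop := IsDgla {
  dgla_graded : is_graded L;
  dgla_d_linear : linear (dgla_d (L:=L));
  dgla_d_deg : forall i x, deg L i x -> deg L (i + 1) (dgla_d x);
  dgla_d_square : forall x : L, dgla_d (dgla_d x) = 0;
  dgla_lie : is_graded_lie (deg L) (fun=> dgla_br (L:=L));
  dgla_leibniz : forall i (x y : L), deg L i x ->
    dgla_d (dgla_br x y) =
      dgla_br (dgla_d x) y + (-1 : K) ^ i *: dgla_br x (dgla_d y) }.

Definition MC (K : fieldType) (L : dgla_data K) : set L :=
  [set X | deg L 1 X /\ dgla_d X + 2^-1 *: dgla_br X X = 0].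

Definition twisted_d (K : fieldType) (L : dgla_data K) (X x : L) : L :=
  dgla_d x + dgla_br X x.

Record gca_data (K : fieldType) := GcaData {
  gca_space :> graded_space K;
  wedge : gca_space -> gca_space -> gca_space }.
Arguments wedge {K B} a b : rename.

Record is_gca (K : fieldType) (B : gca_data K) : Prop := IsGca {
  gca_graded : is_graded B;
  wedge_bilinear : bilinear_for *:%R *:%R (wedge (B:=B));
  wedge_deg : forall i j (a b : B),
    deg B i a -> deg B j b -> deg B (i + j) (wedge a b);
  wedge_assoc : associative (wedge (B:=B));
  wedge_comm : forall i j (a b : B), deg B i a -> deg B j b ->
    wedge a b = (-1 : K) ^ (i * j) *: wedge b a }.

(* [a, b] for a homogeneous of degree i *)
Definition bv_bracket (K : fieldType) (B : gca_data K) (delta : B -> B)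
    (i : int) (a b : B) : B :=
  (-1 : K) ^ i *: (delta (wedge a b) - wedge (delta a) b
                   - (-1 : K) ^ i *: wedge a (delta b)).

Record is_BV (K : fieldType) (B : gca_data K) (delta : B -> B) : Prop := IsBV {
  bv_gca : is_gca B;
  bv_linear : linear delta;
  bv_deg : forall i a, deg B i a -> deg B (i - 1) (delta a);
  bv_square : forall a, delta (delta a) = 0;
  bv_lie : is_graded_lie (fun i => deg B (i + 1))
                         (fun i => bv_bracket delta (i + 1));
  bv_order_two : forall i j l (a b c : B),
    deg B i a -> deg B j b -> deg B l c ->
    delta (wedge (wedge a b) c) - wedge (delta (wedge a b)) c
    + wedge (wedge (delta a) b) c
    - (-1 : K) ^ i *: wedge a (delta (wedge b c))
    - (-1 : K) ^ ((i + 1) * j) *: wedge b (delta (wedge a c))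
    + (-1 : K) ^ i *: wedge (wedge a (delta b)) c
    + (-1 : K) ^ (i + j) *: wedge (wedge a b) (delta c) = 0 }.

(* Only the values of p on L^i x B^(i+1) matter. By non-degeneracy, the maps
   delta and rho below are unique on the degrees where they are used. *)
Record is_MCP (K : fieldType) (L : dgla_data K) (B : gca_data K)
    (p : L -> B -> K) : Prop := IsMCP {
  mcp_dgla : is_dgla L;
  mcp_gca : is_gca B;
  mcp_bilinear : bilinear_for *%R *%R p;
  mcp_nondegl : forall i (x : L), deg L i x ->
    (forall b, deg B (i + 1) b -> p x b = 0) -> x = 0;
  mcp_nondegr : forall i (b : B), deg B (i + 1) b ->
    (forall x, deg L i x -> p x b = 0) -> b = 0;
  mcp_MC : forall X : L, MC X ->
    twisted_d X X = 0 /\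
    exists delta : B -> B,
      [/\ forall i (x : L) (b : B), deg L i x -> deg B (i + 2) b ->
            p (twisted_d X x) b = p x (delta b),
          is_BV delta &
          exists (k : K) (rho : {linear B -> L}),
            [/\ forall a, deg B 1 a -> deg L 0 (rho a),
                forall a b, deg B 1 a -> deg B 1 b ->
                  p X (wedge a b) = p (rho a) b &
                forall a b, deg B 1 a -> deg B 1 b ->
                  dgla_br (rho a) (rho b) =
                    k *: rho (bv_bracket delta 1 a b)]] }.

Arguments MC {K} L _.
Arguments is_MCP {K} L B p.

Record is_lie_bracket (K : fieldType) (g : lmodType K) (br : g -> g -> g) :
    Prop := IsLieBracket {
  lie_bilinear : bilinear_for *:%R *:%R br;
  lie_alternating : forall a, br a a = 0;
  lie_jacobi : forall a b c,
    br a (br b c) + br b (br c a) + br c (br a b) = 0 }.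

Record lieAlgebra (K : fieldType) := LieAlgebra {
  lie_space :> vectType K;
  lie_br : lie_space -> lie_space -> lie_space;
  lie_brP : is_lie_bracket lie_br }.
Arguments lie_br {K g} a b : rename.

Section AlternatingForms.
Variables (K : fieldType) (g : lmodType K).
Implicit Types (X Y : seq g -> K^o) (s : seq g).

(* X stands for a family of forms, one in each arity: X s is the value of the
   alternating n-form of the family for the arguments s, where n = size s. *)
Definition is_alternating X : Prop :=
  (forall s1 s2 (c : K) u v,
     X (s1 ++ (c *: u + v) :: s2) = c * X (s1 ++ u :: s2) + X (s1 ++ v :: s2)) /\
  (forall s1 s2 s3 u, X (s1 ++ u :: s2 ++ u :: s3) = 0).

Definition alternating : {pred seq g -> K^o} := fun X => `[< is_alternating X >].

Let addE X Y s : (X + Y) s = X s + Y s. Proof. by []. Qed.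
Let scaleE (c : K) X s : (c *: X) s = c * X s. Proof. by []. Qed.

Lemma alternating_closed : GRing.subsemimod_closed alternating.
Proof.
split; first split.
- by apply/asboolP; split=> *; rewrite /GRing.zero /= ?mulr0 ?addr0.
- move=> X Y /asboolP[X1 X2] /asboolP[Y1 Y2]; apply/asboolP; split=> *.
    by rewrite !addE X1 Y1 mulrDr addrACA.
  by rewrite addE X2 Y2 addr0.
- move=> c X /asboolP[X1 X2]; apply/asboolP; split=> *.
    by rewrite !scaleE X1 mulrDr mulrCA.
  by rewrite scaleE X2 mulr0.
Qed.

Record altform := AltForm {
  altform_val :> seq g -> K^o;
  altform_valP : altform_val \in alternating }.

HB.instance Definition _ := [isSub for altform_val].
HB.instance Definition _ := [Choice of altform by <:].
HB.instance Definition _ :=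
  GRing.SubChoice_isSubLmodule.Build K (seq g -> K^o) alternating altform
    alternating_closed.

Definition contract_fun (v : g) X : seq g -> K^o := fun s => X (v :: s).

Lemma contract_alternating v X :
  X \in alternating -> contract_fun v X \in alternating.
Proof.
move=> /asboolP[X1 X2]; apply/asboolP; split=> [s1|s1] *.
  exact: (X1 (v :: s1)).
exact: (X2 (v :: s1)).
Qed.

Definition contract (v : g) (X : altform) : altform :=
  AltForm (contract_alternating v (altform_valP X)).

End AlternatingForms.

Section ChevalleyEilenberg.
Variables (K : fieldType) (g : lieAlgebra K).
Implicit Types (X Y : seq g -> K^o) (s : seq g).

Definition del (i : nat) s : seq g := take i s ++ drop i.+1 s.

(* Counting the arguments from 0 instead of 1 does not change (-1)^(i+j). *)
Definition CE_fun X s : K^o :=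
  \sum_(j < size s) \sum_(i < j)
    (-1) ^+ (i + j) * X (lie_br s`_i s`_j :: del i (del j s)).

Let addE X Y s : (X + Y) s = X s + Y s. Proof. by []. Qed.
Let oppE X s : (- X) s = - X s. Proof. by []. Qed.

Let nalternating n X : Prop :=
  (forall s1 s2 (c : K) u v, (size (s1 ++ u :: s2) <= n)%N ->
     X (s1 ++ (c *: u + v) :: s2) = c * X (s1 ++ u :: s2) + X (s1 ++ v :: s2)) /\
  (forall s1 s2 s3 u, (size (s1 ++ u :: s2 ++ u :: s3) <= n)%N ->
     X (s1 ++ u :: s2 ++ u :: s3) = 0).

Let nalternatingB n X Y :
  nalternating n X -> nalternating n Y -> nalternating n (X - Y).
Proof.
move=> [X1 X2] [Y1 Y2]; split=> *; rewrite !addE !oppE.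
  by rewrite X1// Y1// mulrBr opprD addrACA.
by rewrite X2// Y2// subr0.
Qed.

Let alternating_n n X : X \in @alternating K g -> nalternating n X.
Proof. by move=> /asboolP[X1 X2]; split. Qed.

Let nalternating_cons n X :
  (forall (c : K) u v s, X (c *: u + v :: s) = c * X (u :: s) + X (v :: s)) ->
  (forall u s, X [:: u, u & s] = 0) ->
  (forall v, nalternating n (contract_fun v X)) ->
  nalternating n.+1 X.
Proof.
move=> Xl Xa Xc; split=> [[|w s1] s2 c u v|[|w s1] s2 s3 u] /=; rewrite ?ltnS.
- by rewrite Xl.
- exact: ((Xc w).1 s1).
- case: s2 => [|b s2] /=; first by rewrite Xa.
  move=> sz; have := Xa (1 *: u + b) (s2 ++ u :: s3).
  have l2 w (c d : g) : X [:: w, 1 *: c + d & s2 ++ u :: s3] =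
      1 * X [:: w, c & s2 ++ u :: s3] + X [:: w, d & s2 ++ u :: s3].
    by apply: ((Xc w).1 [::]); rewrite /= !size_cat/= in sz *.
  rewrite Xl !l2 !Xa !mul1r add0r addr0.
  have -> : X [:: b, u & s2 ++ u :: s3] = 0.
    by apply: ((Xc b).2 [::]).
  by rewrite addr0.
- exact: ((Xc w).2 s1).
Qed.

Let lieDl (c : K) (u v w : g) :
  lie_br (c *: u + v) w = c *: lie_br u w + lie_br v w.
Proof. by have [[brl _] _ _] := lie_brP g; rewrite brl. Qed.

Let lieDr (c : K) (u v w : g) :
  lie_br w (c *: u + v) = c *: lie_br w u + lie_br w v.
Proof. by have [[_ brr] _ _] := lie_brP g; rewrite brr. Qed.

Let lie_self (u : g) : lie_br u u = 0.
Proof. by have [_ ? _] := lie_brP g. Qed.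

Let alt_swap X a b s : X \in @alternating K g -> X [:: a, b & s] = - X [:: b, a & s].
Proof.
move=> /asboolP[X1 X2]; have := X2 [::] [::] s (1 *: a + b).
rewrite /= (X1 [::] _ 1) (X1 [:: a] _ 1) (X1 [:: b] _ 1) /= !mul1r.
rewrite (X2 [::] [::]) (X2 [::] [::]) add0r addr0 => /eqP.
by rewrite addr_eq0 => /eqP.
Qed.

Let lie_der (v : g) X : seq g -> K^o := fun s =>
  \sum_(j < size s) (-1) ^+ j.+1 * X (lie_br v s`_j :: del j s).

Let del0 a s : del 0 (a :: s) = s. Proof. by rewrite /del /= drop0. Qed.

Let lie_der_cons v a X s : X \in @alternating K g ->
  lie_der v X (a :: s) =
  lie_der v (contract_fun a X) s - X (lie_br v a :: s).
Proof.
move=> Xalt; rewrite /lie_der /= big_ord_recl /= del0 expr1 mulN1r addrC.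
congr (_ - _); apply: eq_bigr => j _.
rewrite /bump add1n (_ : del j.+1 _ = a :: del j s)// alt_swap// mulrN.
by rewrite [in LHS]exprS mulN1r mulNr opprK.
Qed.

Let CE_cons v X s : X \in @alternating K g ->
  CE_fun X (v :: s) = lie_der v X s - CE_fun (contract_fun v X) s.
Proof.
move=> Xalt; rewrite /CE_fun /= big_ord_recl big_ord0 add0r -sumrB.
apply: eq_bigr => j _; rewrite big_ord_recl /=; congr (_ + _).
  by rewrite /bump /= add0n add1n del0.
rewrite -sumrN; apply: eq_bigr => i _.
rewrite /bump /= !add1n addSn addnS !exprS !mulN1r opprK.
rewrite (_ : del i.+1 _ = v :: del i (del j s)); last by [].
by rewrite alt_swap// mulrN.
Qed.

Let lie_der_nalt n v X : X \in @alternating K g -> nalternating n (lie_der v X).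
Proof.
elim: n X => [|n IHn] X Xalt.
  by split=> [s1 s2 c u w|s1 s2 s3 u]; rewrite size_cat addnS.
have [X1 X2] := asboolW Xalt.
apply: nalternating_cons => [c u w s|u s|w].
- rewrite !lie_der_cons// lieDr (X1 [::]) /= opprD mulrBr [RHS]addrACA.
  congr (_ + _); rewrite /lie_der big_distrr -big_split.
  by apply: eq_bigr => j _ /=; rewrite /contract_fun (X1 [::]) mulrDr mulrCA.
- rewrite !lie_der_cons ?contract_alternating// /contract_fun.
  rewrite [X in _ - _ - X]alt_swap// opprK subrK.
  by rewrite /lie_der big1// => j _; rewrite (X2 [::] [::]) mulr0.
- rewrite (_ : contract_fun w _ = lie_der v (contract_fun w X)
                                  - contract_fun (lie_br v w) X).
    by apply/nalternatingB/alternating_n/contract_alternating/Xalt/IHn;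
       exact: contract_alternating.
  by apply/funext => s; rewrite addE oppE /contract_fun -lie_der_cons.
Qed.

Let head0 X s : X \in @alternating K g -> X (0 :: s) = 0.
Proof.
move=> /asboolP[X1 _]; have := X1 [::] s 1 0 0.
rewrite /= scale1r addr0 mul1r => /(congr1 (+%R^~ (- X (0 :: s)))).
by rewrite subrr addrK.
Qed.

Let CE_nalt n X : X \in @alternating K g -> nalternating n (CE_fun X).
Proof.
elim: n X => [|n IHn] X Xalt.
  by split=> [s1 s2 c u w|s1 s2 s3 u]; rewrite size_cat addnS.
have [X1 X2] := asboolW Xalt.
apply: nalternating_cons => [c u w s|u s|w].
- rewrite !CE_cons// mulrBr [RHS]addrACA -opprD; congr (_ - _).
    rewrite /lie_der big_distrr -big_split; apply: eq_bigr => j _ /=.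
    by rewrite lieDl (X1 [::]) mulrDr mulrCA.
  rewrite /CE_fun big_distrr -big_split; apply: eq_bigr => j _ /=.
  rewrite big_distrr -big_split; apply: eq_bigr => i _ /=.
  by rewrite /contract_fun (X1 [::]) mulrDr mulrCA.
- have uX := contract_alternating u Xalt.
  rewrite CE_cons// lie_der_cons// CE_cons// lie_self head0// subr0.
  rewrite opprB addrCA subrr addr0 /CE_fun big1// => j _; rewrite big1// => i _.
  by rewrite /contract_fun (X2 [::] [::]) mulr0.
- rewrite (_ : contract_fun w _ = lie_der w X - CE_fun (contract_fun w X)).
    by apply/nalternatingB/IHn/contract_alternating/Xalt/lie_der_nalt.
  by apply/funext => s; rewrite addE oppE -CE_cons.
Qed.

Lemma CE_alternating X :
  X \in @alternating K g -> CE_fun X \in @alternating K g.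
Proof.
move=> Xalt; apply/asboolP; split=> [s1 s2 c u v|s1 s2 s3 u].
  by apply: (CE_nalt _ Xalt).1; exact: leqnn.
by apply: (CE_nalt _ Xalt).2; exact: leqnn.
Qed.

Definition CE_d (X : altform g) : altform g :=
  AltForm (CE_alternating (altform_valP X)).

(* L^i is the space of alternating (i+1)-forms; in particular L^(-1) = K. *)
Definition CE_space : graded_space K :=
  GradedSpace (fun (i : int) => [set X : altform g |
    forall s, (size s)%:Z != i + 1 -> X s = 0]).

Definition CE_dgla : dgla_data K :=
  @DglaData K CE_space CE_d (fun _ _ => 0).

Definition cocycles2 : set (altform g) :=
  [set X | CE_d X = 0] `&` [set X | forall s, size s != 2%N -> X s = 0].

End ChevalleyEilenberg.
Arguments cocycles2 {K} g _.

(* The exterior algebra of g is presented as the K-algebra generated by g,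
   linearly, subject to the relations v ∧ v = 0. *)
Section ExteriorAlgebra.
Variables (K : fieldType) (g : lmodType K).

Inductive ext_term :=
| EGen of g
| EZero
| EOne
| EAdd of ext_term & ext_term
| EScale of K & ext_term
| EMul of ext_term & ext_term.

Inductive ext_cong : ext_term -> ext_term -> Prop :=
| cong_refl t : ext_cong t t
| cong_sym t u : ext_cong t u -> ext_cong u t
| cong_trans t u v : ext_cong t u -> ext_cong u v -> ext_cong t v
| cong_congD t t' u u' :
    ext_cong t t' -> ext_cong u u' -> ext_cong (EAdd t u) (EAdd t' u')
| cong_congZ c t t' : ext_cong t t' -> ext_cong (EScale c t) (EScale c t')
| cong_congM t t' u u' :
    ext_cong t t' -> ext_cong u u' -> ext_cong (EMul t u) (EMul t' u')
| cong_addA t u v : ext_cong (EAdd t (EAdd u v)) (EAdd (EAdd t u) v)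
| cong_addC t u : ext_cong (EAdd t u) (EAdd u t)
| cong_add0 t : ext_cong (EAdd EZero t) t
| cong_addN t : ext_cong (EAdd (EScale (- 1) t) t) EZero
| cong_scaleA c d t : ext_cong (EScale c (EScale d t)) (EScale (c * d) t)
| cong_scale1 t : ext_cong (EScale 1 t) t
| cong_scaleDr c t u :
    ext_cong (EScale c (EAdd t u)) (EAdd (EScale c t) (EScale c u))
| cong_scaleDl c d t :
    ext_cong (EScale (c + d) t) (EAdd (EScale c t) (EScale d t))
| cong_mulA t u v : ext_cong (EMul t (EMul u v)) (EMul (EMul t u) v)
| cong_mul1l t : ext_cong (EMul EOne t) t
| cong_mul1r t : ext_cong (EMul t EOne) t
| cong_mulDl t u v : ext_cong (EMul (EAdd t u) v) (EAdd (EMul t v) (EMul u v))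
| cong_mulDr t u v : ext_cong (EMul t (EAdd u v)) (EAdd (EMul t u) (EMul t v))
| cong_scaleAl c t u : ext_cong (EScale c (EMul t u)) (EMul (EScale c t) u)
| cong_scaleAr c t u : ext_cong (EScale c (EMul t u)) (EMul t (EScale c u))
| cong_gen_linear c v w :
    ext_cong (EGen (c *: v + w)) (EAdd (EScale c (EGen v)) (EGen w))
| cong_gen_square v : ext_cong (EMul (EGen v) (EGen v)) EZero.

(* The action of the exterior algebra on forms by contraction:
   (v1 ∧ ... ∧ vn) . X = X(v1, ..., vn, -). *)
Fixpoint ext_act (t : ext_term) (X : altform g) : altform g :=
  match t with
  | EGen v => contract v X
  | EZero => 0
  | EOne => X
  | EAdd t u => ext_act t X + ext_act u X
  | EScale c t => c *: ext_act t X
  | EMul t u => ext_act u (ext_act t X)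
  end.

Lemma contract_linear v : linear (contract v : altform g -> altform g).
Proof. by move=> c X Y; apply/val_inj. Qed.

Lemma ext_act_linear t : linear (ext_act t).
Proof.
elim: t => [v|||t IHt u IHu|d t IHt|t IHt u IHu] c X Y //=.
- exact: contract_linear.
- by rewrite scaler0 addr0.
- by rewrite IHt IHu scalerDr addrACA.
- by rewrite IHt scalerDr !scalerA mulrC.
- by rewrite IHt IHu.
Qed.

Lemma ext_act_cong t u : ext_cong t u -> ext_act t = ext_act u.
Proof.
have lin0 w : ext_act w 0 = 0.
  rewrite -[X in ext_act w X](subrr 0) -scaleN1r addrC ext_act_linear.
  by rewrite scaleN1r addNr.
have linD w X Y : ext_act w (X + Y) = ext_act w X + ext_act w Y.
  by rewrite -[X]scale1r ext_act_linear !scale1r.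
have linZ w c X : ext_act w (c *: X) = c *: ext_act w X.
  by rewrite -[c *: X]addr0 ext_act_linear lin0 addr0.
elim=> /= {t u}; do ?[by move=> *; apply/funext => X; congruence].
- by move=> t u v; apply/funext => X; rewrite addrA.
- by move=> t u; apply/funext => X; rewrite addrC.
- by move=> t; apply/funext => X; rewrite add0r.
- by move=> t; apply/funext => X; rewrite scaleN1r addNr.
- by move=> c d t; apply/funext => X; rewrite scalerA.
- by move=> t; apply/funext => X; rewrite scale1r.
- by move=> c t u; apply/funext => X; rewrite scalerDr.
- by move=> c d t; apply/funext => X; rewrite scalerDl.
- by move=> c t u; apply/funext => X; rewrite linZ.
- move=> c v w; apply/funext => X; apply/val_inj/funext => s /=.
  by have /asboolP[X1 _] := altform_valP X; exact: (X1 [::]).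
- move=> v; apply/funext => X; apply/val_inj/funext => s /=.
  by have /asboolP[_ X2] := altform_valP X; exact: (X2 [::] [::]).
Qed.

HB.instance Definition _ := gen_eqMixin ext_term.
HB.instance Definition _ := gen_choiceMixin ext_term.

Definition ext_rel : rel ext_term := fun t u => `[< ext_cong t u >].

Let ext_rel_refl : reflexive ext_rel.
Proof. by move=> t; apply/asboolP/cong_refl. Qed.

Let ext_rel_sym : symmetric ext_rel.
Proof. by move=> t u; apply/asboolP/asboolP; apply: cong_sym. Qed.

Let ext_rel_trans : transitive ext_rel.
Proof.
by move=> t u v /asboolP ut /asboolP tv; apply/asboolP/(cong_trans ut tv).
Qed.

Canonical ext_equiv := EquivRel ext_rel ext_rel_refl ext_rel_sym ext_rel_trans.

Definition ext : Type := {eq_quot ext_equiv}.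

HB.instance Definition _ := Choice.on ext.
HB.instance Definition _ := EqQuotient.on ext.

Let pi_cong t u : ext_cong t u -> \pi_ext t = \pi_ext u.
Proof. by move=> tu; apply/eqmodP/asboolP. Qed.

Let cong_repr t : ext_cong (repr (\pi_ext t)) t.
Proof.
apply/asboolP; rewrite -[X in is_true X]/(ext_equiv _ _).
by apply/eqmodP; rewrite reprK.
Qed.

Definition ext_gen (v : g) : ext := \pi_ext (EGen v).
Definition ext_zero : ext := \pi_ext EZero.
Definition ext_one : ext := \pi_ext EOne.
Definition ext_add (a b : ext) : ext := \pi_ext (EAdd (repr a) (repr b)).
Definition ext_scale (c : K) (a : ext) : ext := \pi_ext (EScale c (repr a)).
Definition ext_opp (a : ext) : ext := ext_scale (- 1) a.
Definition ext_mul (a b : ext) : ext := \pi_ext (EMul (repr a) (repr b)).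

Lemma ext_piD t u : \pi_ext (EAdd t u) = ext_add (\pi_ext t) (\pi_ext u).
Proof. by apply/pi_cong/cong_congD; apply/cong_sym/cong_repr. Qed.

Lemma ext_piZ c t : \pi_ext (EScale c t) = ext_scale c (\pi_ext t).
Proof. by apply/pi_cong/cong_congZ; apply/cong_sym/cong_repr. Qed.

Lemma ext_piM t u : \pi_ext (EMul t u) = ext_mul (\pi_ext t) (\pi_ext u).
Proof. by apply/pi_cong/cong_congM; apply/cong_sym/cong_repr. Qed.

Let ext_ind (P : ext -> Prop) : (forall t, P (\pi_ext t)) -> forall a, P a.
Proof. by move=> Ppi a; rewrite -[a]reprK. Qed.

Let ext_addrA : associative ext_add.
Proof.
do 3![elim/ext_ind=> ?]; rewrite -!ext_piD; exact/pi_cong/cong_addA.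
Qed.

Let ext_addrC : commutative ext_add.
Proof.
by do 2![elim/ext_ind=> ?]; rewrite -!ext_piD; exact/pi_cong/cong_addC.
Qed.

Let ext_add0r : left_id ext_zero ext_add.
Proof. by elim/ext_ind=> ?; rewrite -ext_piD; exact/pi_cong/cong_add0. Qed.

Let ext_addNr : left_inverse ext_zero ext_opp ext_add.
Proof.
elim/ext_ind=> ?; rewrite /ext_opp -ext_piZ -ext_piD.
exact/pi_cong/cong_addN.
Qed.

HB.instance Definition _ :=
  GRing.isZmodule.Build ext ext_addrA ext_addrC ext_add0r ext_addNr.

Let ext_addE (a b : ext) : a + b = ext_add a b. Proof. by []. Qed.

Let ext_scalerA c d a : ext_scale c (ext_scale d a) = ext_scale (c * d) a.
Proof.
by elim/ext_ind: a => ?; rewrite -!ext_piZ; exact/pi_cong/cong_scaleA.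
Qed.

Let ext_scale1r : left_id 1 ext_scale.
Proof. by elim/ext_ind=> ?; rewrite -!ext_piZ; exact/pi_cong/cong_scale1. Qed.

Let ext_scalerDr : right_distributive ext_scale +%R.
Proof.
move=> c; do 2![elim/ext_ind=> ?]; rewrite !ext_addE -ext_piD -!ext_piZ.
by rewrite -ext_piD; exact/pi_cong/cong_scaleDr.
Qed.

Let ext_scalerDl a : {morph ext_scale^~ a : c d / c + d >-> c + d}.
Proof.
move=> c d; elim/ext_ind: a => ?; rewrite ext_addE -!ext_piZ.
by rewrite -ext_piD; exact/pi_cong/cong_scaleDl.
Qed.

HB.instance Definition _ := GRing.Zmodule_isLmodule.Build K ext
  ext_scalerA ext_scale1r ext_scalerDr ext_scalerDl.

Let ext_scaleE c (a : ext) : c *: a = ext_scale c a. Proof. by []. Qed.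

Let ext_mulrA : associative ext_mul.
Proof.
by do 3![elim/ext_ind=> ?]; rewrite -!ext_piM; exact/pi_cong/cong_mulA.
Qed.

Let ext_mul1r : left_id ext_one ext_mul.
Proof. by elim/ext_ind=> ?; rewrite -!ext_piM; exact/pi_cong/cong_mul1l. Qed.

Let ext_mulr1 : right_id ext_one ext_mul.
Proof. by elim/ext_ind=> ?; rewrite -!ext_piM; exact/pi_cong/cong_mul1r. Qed.

Let ext_mulrDl : left_distributive ext_mul +%R.
Proof.
do 3![elim/ext_ind=> ?]; rewrite !ext_addE -!(ext_piD, ext_piM).
exact/pi_cong/cong_mulDl.
Qed.

Let ext_mulrDr : right_distributive ext_mul +%R.
Proof.
do 3![elim/ext_ind=> ?]; rewrite !ext_addE -!(ext_piD, ext_piM).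
exact/pi_cong/cong_mulDr.
Qed.

Let unit_fun : seq g -> K^o := fun s => (nilp s)%:R.

Let unit_alternating : unit_fun \in @alternating K g.
Proof.
by apply/asboolP; split=> [s1 s2 c u v|s1 s2 s3 u];
  rewrite /unit_fun /nilp !size_cat !addnS /= ?mulr0 ?addr0.
Qed.

Let ext_oner_neq0 : ext_one != 0.
Proof.
apply/eqP => /eqmodP/asboolP/ext_act_cong.
move=> /(congr1 (fun f => altform_val (f (AltForm unit_alternating)) [::])).
by move=> /= /eqP; rewrite /unit_fun oner_eq0.
Qed.

HB.instance Definition _ := GRing.Zmodule_isNzRing.Build ext
  ext_mulrA ext_mul1r ext_mulr1 ext_mulrDl ext_mulrDr ext_oner_neq0.

Let ext_mulE (a b : ext) : a * b = ext_mul a b. Proof. by []. Qed.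

Let ext_scalerAl (c : K) (a b : ext) : c *: (a * b) = (c *: a) * b.
Proof.
elim/ext_ind: a => t; elim/ext_ind: b => u.
rewrite !ext_mulE !ext_scaleE -!(ext_piZ, ext_piM).
exact/pi_cong/cong_scaleAl.
Qed.

Let ext_scalerAr (c : K) (a b : ext) : c *: (a * b) = a * (c *: b).
Proof.
elim/ext_ind: a => t; elim/ext_ind: b => u.
rewrite !ext_mulE !ext_scaleE -!(ext_piZ, ext_piM).
exact/pi_cong/cong_scaleAr.
Qed.

HB.instance Definition _ := GRing.Lmodule_isLalgebra.Build K ext ext_scalerAl.
HB.instance Definition _ := GRing.Lalgebra_isAlgebra.Build K ext ext_scalerAr.

Lemma ext_gen_is_linear : linear ext_gen.
Proof.
move=> c v w; rewrite ext_addE ext_scaleE -ext_piZ -ext_piD.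
exact/pi_cong/cong_gen_linear.
Qed.

Lemma ext_gen_sqr v : ext_gen v * ext_gen v = 0.
Proof. by rewrite ext_mulE -ext_piM; exact/pi_cong/cong_gen_square. Qed.

(* Degree n is spanned by the products v1 ∧ ... ∧ vn. *)
Definition ext_space : graded_space K :=
  GradedSpace (fun (i : int) => [set x : ext |
    exists m (c : 'I_m -> K) (v : 'I_m -> seq g),
      (forall j, (size (v j))%:Z = i) /\
      x = \sum_j c j *: \prod_(w <- v j) ext_gen w]).

Definition exterior_algebra : gca_data K :=
  @GcaData K ext_space (fun a b : ext => a * b).

Definition ext_pairing (X : altform g) (a : ext) : K :=
  ext_act (repr a) X [::].

Lemma ext_pairing_prod (X : altform g) (s : seq g) :
  ext_pairing X (\prod_(w <- s) ext_gen w) = X s.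
Proof.
rewrite /ext_pairing.
have -> : \prod_(w <- s) ext_gen w =
    \pi_ext (foldr (fun w t => EMul (EGen w) t) EOne s).
  elim: s => [|w s IHs]; first by rewrite big_nil.
  by rewrite big_cons IHs ext_mulE -ext_piM.
rewrite (ext_act_cong (cong_repr _)).
elim: s X => [//|w s IHs] X; rewrite /= IHs; exact: erefl.
Qed.

End ExteriorAlgebra.
Arguments ext_pairing {K g} X a.

(* Brackets on g ⊕ K making 0 -> K -> g ⊕ K -> g -> 0 a central extension of Lie
   algebras. *)
Record is_central_extension (K : fieldType) (g : lieAlgebra K)
    (br : g * K^o -> g * K^o -> g * K^o) : Prop := IsCentralExtension {
  cext_lie : is_lie_bracket br;
  cext_proj : forall x y, (br x y).1 = lie_br x.1 y.1;
  cext_central : forall (t : K) y, br (0, t) y = 0 }.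

Definition extension_bracket (K : fieldType) (g : lieAlgebra K) (X : altform g)
    (x y : g * K^o) : g * K^o :=
  (lie_br x.1 y.1, X [:: x.1; y.1]).
Arguments is_central_extension {K} g br.
Arguments extension_bracket {K} g X x y.

(* Main.v *)
(* A linear functional on the exterior algebra is an alternating form, and the
   exterior algebra of g is finite-dimensional, so forms separate its points.
   Hence delta exists as the transpose of the Chevalley-Eilenberg differential
   and inherits delta^2 = 0, which itself follows from Cartan's formulas. For a
   generator v, the operator theta_v = delta v + v delta is the transpose of the
   Lie derivative along v, that is, minus the derivation extending [v, -].
   Writing Phi_a(b) = delta(a b) - delta(a) b - (-1)^|a| a delta(b), this gives
   Phi_(v a) = a theta_v - v Phi_a, so that by induction each Phi_a is a graded
   derivation: delta has order two. The Lie axioms for the bracket are formal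
   consequences of this, of delta^2 = 0 and of graded commutativity. As the
   bracket of L vanishes, condition (3) holds with k_X = 0 and
   rho_X(a) = X(a, -). *)
From HB Require Import structures.
Require Import Defs.
From mathcomp Require Import all_boot all_order all_algebra.
From mathcomp Require Import all_classical.
From mathcomp Require Import ring zify.

Set Implicit Arguments.
Unset Strict Implicit.
Unset Printing Implicit Defensive.

Import GRing.Theory.
Local Open Scope ring_scope.
Local Open Scope quotient_scope.

Local Notation ext_prod s := (\prod_(w <- s) ext_gen w).

(** * Linear functionals separating the points of a finite span *)

Section LinearSpan.
Variables (K : fieldType) (V : lmodType K).

(** Spans are expressed by a predicate because [ext g] carries only an [lmodType] structure, not yet
    known to be finite-dimensional. *)
Inductive lin_span (r : seq V) : V -> Prop :=
| lin_span0 : lin_span r 0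
| lin_span_cons c x a : x \in r -> lin_span r a -> lin_span r (c *: x + a).

Lemma lin_spanD r a b : lin_span r a -> lin_span r b -> lin_span r (a + b).
Proof.
by move=> ra rb; elim: ra => [|c x a' xr _ IH]; rewrite ?add0r// -addrA;
  exact: lin_span_cons.
Qed.

Lemma lin_spanZ r c a : lin_span r a -> lin_span r (c *: a).
Proof.
elim=> [|d x b xr _ IH]; first by rewrite scaler0; exact: lin_span0.
by rewrite scalerDr scalerA; exact: lin_span_cons.
Qed.

Lemma lin_span_mem r x : x \in r -> lin_span r x.
Proof.
by move=> xr; rewrite -[x]scale1r -[_ *: _]addr0; apply: lin_span_cons => //;
  exact: lin_span0.
Qed.

Lemma linear_fun0 (U : lmodType K) (f : V -> U) : linear f -> f 0 = 0.
Proof. by move=> /(_ (-1) 0 0); rewrite !scaler0 addr0 scaleN1r addNr. Qed.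

Lemma lin_span_map (f : V -> V) r r' a : linear f ->
  (forall x, x \in r -> lin_span r' (f x)) -> lin_span r a ->
  lin_span r' (f a).
Proof.
move=> fl fr; elim=> [|c x b xr _ IH].
  by rewrite linear_fun0//; exact: lin_span0.
by rewrite fl; apply: lin_spanD => //; exact/lin_spanZ/fr.
Qed.

Section Presentation.
Variable r : seq V.
Hypothesis rV : forall a, lin_span r a.

Let n := size r.
Let comb (x : 'rV[K]_n) : V := \sum_i x 0 i *: r`_i.

Let comb_is_linear : linear comb.
Proof.
move=> c x y; rewrite /comb scaler_sumr -big_split; apply: eq_bigr => i _ /=.
by rewrite !mxE scalerDl scalerA.
Qed.

HB.instance Definition _ := GRing.isLinear.Build K 'rV[K]_n V *:%R comb
  comb_is_linear.

Let comb_surj a : exists x, comb x = a.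
Proof.
elim: (rV a) => [|c x b xr _ [y <-]]; first by exists 0; rewrite linear0.
have ir : (index x r < n)%N by rewrite index_mem.
exists (c *: delta_mx 0 (Ordinal ir) + y); rewrite linearP; congr (_ *: _ + _).
rewrite /= /comb (bigD1 (Ordinal ir)) //= mxE !eqxx scale1r nth_index//.
by rewrite big1 ?addr0// => j /negPf ji; rewrite mxE ji scale0r.
Qed.

(** Among the matrices whose rows are relations, one of maximal rank has all relations in its row
    space: a further relation cannot raise the rank. *)
Let comb_ker : exists A : 'M[K]_n,
  forall x, comb x = 0 <-> (x <= A)%MS.
Proof.
pose kerA (A : 'M[K]_n) := forall x : 'rV_n, (x <= A)%MS -> comb x = 0.
have exA : exists k, `[< exists2 A, kerA A & \rank A = k >].
  exists 0%N; apply/asboolP; exists 0; last exact: mxrank0.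
  by move=> x; rewrite submx0 => /eqP->; rewrite linear0.
have ubA k : `[< exists2 A, kerA A & \rank A = k >] -> (k <= n)%N.
  by move=> /asboolP[A _ <-]; exact: rank_leq_row.
have [k /asboolP[A Aker rkA] maxk] := ex_maxnP exA ubA.
exists A => x; split=> [x0|]; last exact: Aker.
have : (\rank (A + x)%MS <= \rank A)%N.
  rewrite rkA; apply/maxk/asboolP; exists (A + x)%MS => // y.
  move=> /sub_addsmxP[[u v] /= ->]; rewrite linearD/= Aker ?submxMl// add0r.
  by rewrite [v]mx11_scalar mul_scalar_mx linearZ/= x0 scaler0.
move=> rkAx; apply: submx_trans (addsmxSr A x) _.
have [_ <-] := mxrank_leqif_sup (addsmxSl A x).
by rewrite eqn_leq rkAx mxrankS ?addsmxSl.
Qed.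

(** A set-theoretic section [sec] of [comb] is linear modulo the relations, and [cokermx A] kills
    exactly these. The coordinates of [sec v *m cokermx A] are thus linear in [v] and vanish
    together only at 0. *)
Lemma separating_functional a : a != 0 ->
  exists2 f : V -> K^o, linear f & f a != 0.
Proof.
move=> a0; have [A kerA] := comb_ker.
have [sec secK] := choice comb_surj.
have : sec a *m cokermx A != 0.
  by rewrite -submxE; apply: contra a0 => /kerA; rewrite secK => ->.
move=> /eqP a1; have [j aj] : exists j, (sec a *m cokermx A) 0 j != 0.
  apply: contrapT => noj; apply: a1; apply/rowP => j; rewrite [RHS]mxE.
  by apply: contrapT => /eqP ?; apply: noj; exists j.
exists (fun v => (sec v *m cokermx A) 0 j) => // c u v.
suff : (sec (c *: u + v) - (c *: sec u + sec v)) *m cokermx A == 0.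
  rewrite mulmxBl subr_eq0 => /eqP ->.
  by rewrite mulmxDl -scalemxAl !mxE.
by rewrite -submxE; apply/kerA; rewrite linearB linearP/= !secK subrr.
Qed.

End Presentation.
End LinearSpan.

(** * Pairing of the exterior algebra with forms *)

Section Monomials.
Variables (K : fieldType) (g : lmodType K).
Implicit Types (a b : ext g) (X : altform g).

HB.instance Definition _ :=
  GRing.isLinear.Build K g (ext g) *:%R (@ext_gen K g) (@ext_gen_is_linear K g).

Lemma ext_genZ c (v : g) : ext_gen (c *: v) = c *: ext_gen v.
Proof. exact: linearZ. Qed.

Lemma ext_ind (P : ext g -> Prop) :
  (forall t, P (\pi_(ext g) t)) -> forall a, P a.
Proof. by move=> Ppi a; rewrite -[a]reprK. Qed.

Lemma pi_extD t u :
  \pi_(ext g) (EAdd t u) = \pi_(ext g) t + \pi_(ext g) u :> ext g.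
Proof. exact: ext_piD. Qed.

Lemma pi_extZ c t : \pi_(ext g) (EScale c t) = c *: (\pi_(ext g) t : ext g).
Proof. exact: ext_piZ. Qed.

Lemma pi_extM t u :
  \pi_(ext g) (EMul t u) = (\pi_(ext g) t : ext g) * (\pi_(ext g) u : ext g).
Proof. exact: ext_piM. Qed.

(** Monomials span, by induction on a representing term: sums concatenate the expansions and
    products multiply them out. *)
Lemma ext_monomial_ind (P : ext g -> Prop) :
  P 0 -> (forall c s a, P a -> P (c *: ext_prod s + a)) -> forall a, P a.
Proof.
move=> P0 PD.
suff spanP : forall a, exists r : seq (K * seq g),
    a = \sum_(x <- r) x.1 *: ext_prod x.2.
  by move=> a; have [r ->] := spanP a; elim: r => [|x r IH];
    rewrite ?big_nil ?big_cons//; exact: PD.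
elim/ext_ind; elim=> [v|||t [r tr] u [s us]|c t [r tr]|t [r tr] u [s us]].
- by exists [:: (1, [:: v])]; rewrite !big_seq1 scale1r.
- by exists [::]; rewrite big_nil.
- by exists [:: (1, [::])]; rewrite big_seq1 big_nil scale1r.
- by exists (r ++ s); rewrite big_cat pi_extD tr us.
- exists [seq (c * x.1, x.2) | x <- r]; rewrite pi_extZ tr big_map scaler_sumr.
  by apply: eq_bigr => x _; rewrite scalerA.
- exists [seq (x.1 * y.1, x.2 ++ y.2) | x <- r, y <- s].
  rewrite pi_extM tr us big_allpairs_dep mulr_suml.
  apply: eq_bigr => x _; rewrite mulr_sumr; apply: eq_bigr => y _ /=.
  by rewrite big_cat/= -scalerAl -scalerAr scalerA.
Qed.

Lemma ext_gen_anticomm (v w : g) :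
  ext_gen v * ext_gen w = - (ext_gen w * ext_gen v).
Proof.
have := ext_gen_sqr (v + w); rewrite linearD/= mulrDl !mulrDr !ext_gen_sqr.
by rewrite add0r addr0 => /eqP; rewrite addr_eq0 => /eqP.
Qed.

Lemma ext_gen_prodC v (s : seq g) :
  ext_gen v * ext_prod s = (-1) ^+ size s *: (ext_prod s * ext_gen v).
Proof.
elim: s => [|w s IH]; first by rewrite !big_nil mulr1 mul1r scale1r.
rewrite !big_cons mulrA ext_gen_anticomm mulNr -[in LHS]mulrA IH -scalerAr mulrA.
by rewrite exprS mulN1r scaleNr.
Qed.

Lemma ext_prodC (s t : seq g) : ext_prod s * ext_prod t =
  (-1) ^+ (size s * size t) *: (ext_prod t * ext_prod s).
Proof.
elim: s => [|v s IH]; first by rewrite big_nil mulr1 mul1r scale1r.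
rewrite !big_cons -mulrA IH -scalerAr (mulrA (ext_gen v)) ext_gen_prodC.
by rewrite -scalerAl scalerA mulrA -exprD mulSn addnC.
Qed.

(** Moving one copy of a repeated argument next to the other produces the square of a generator. *)
Lemma ext_prod_alternating (f : ext g -> K^o) : linear f ->
  (fun s => f (ext_prod s)) \in alternating (g:=g).
Proof.
move=> fl; apply/asboolP; split=> [s1 s2 c u v|s1 s2 s3 u].
  rewrite !big_cat !big_cons/= linearP/= mulrDl mulrDr -scalerAl -scalerAr fl.
  by [].
rewrite big_cat big_cons big_cat big_cons/= (mulrA (ext_gen u)) ext_gen_prodC.
rewrite -!scalerAl !mulrA -(mulrA _ (ext_gen u)) mulrA.
rewrite -(mulrA (ext_prod s2)) ext_gen_sqr mulr0 mul0r scaler0 mulr0.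
exact: linear_fun0.
Qed.

Lemma ext_pairing_pi X t : ext_pairing X (\pi_(ext g) t) = ext_act t X [::].
Proof.
rewrite /ext_pairing (@ext_act_cong _ _ _ t)//.
by apply/asboolP; rewrite -[X in is_true X]/(ext_equiv g _ _);
  apply/eqmodP; rewrite reprK.
Qed.

Lemma ext_pairing_is_linear X : linear_for *%R (ext_pairing X).
Proof.
move=> c; elim/ext_ind=> t; elim/ext_ind=> u.
by rewrite -pi_extZ -pi_extD !ext_pairing_pi.
Qed.

HB.instance Definition _ X := GRing.isLinear.Build K (ext g) K *%R
  (ext_pairing X) (ext_pairing_is_linear X).

Lemma ext_pairing_linearl a : linear_for *%R (fun X => ext_pairing X a : K).
Proof. by move=> c X Y; rewrite /ext_pairing ext_act_linear. Qed.

Lemma ext_pairing0l a : ext_pairing 0 a = 0.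
Proof.
exact: (linear_fun0 (U := K^o) (f := ext_pairing^~ a) (ext_pairing_linearl a)).
Qed.

Lemma ext_pairingDl a X Y :
  ext_pairing (X + Y) a = ext_pairing X a + ext_pairing Y a.
Proof. by have := ext_pairing_linearl a 1 X Y; rewrite scale1r mul1r. Qed.

Lemma ext_pairingBl a X Y :
  ext_pairing (X - Y) a = ext_pairing X a - ext_pairing Y a.
Proof.
by rewrite -(scaleN1r Y) [X + _]addrC ext_pairing_linearl mulN1r addrC.
Qed.

Lemma ext_pairingM X a b :
  ext_pairing X (a * b) = ext_pairing (ext_act (repr a) X) b.
Proof.
rewrite -{1}[a]reprK; elim/ext_ind: b => t.
by rewrite -pi_extM !ext_pairing_pi.
Qed.

Lemma ext_pairing_genM X v a :
  ext_pairing X (ext_gen v * a) = ext_pairing (contract v X) a.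
Proof. by elim/ext_ind: a => t; rewrite -pi_extM !ext_pairing_pi. Qed.

End Monomials.

(** * Finite dimension of the exterior algebra and transposes *)

Section FiniteDimension.
Variables (K : fieldType) (g : vectType K).
Implicit Types (a b : ext g) (X : altform g) (e s : seq g).

(** The ordered products over all subfamilies of [e], the usual spanning family when [e] is a
    basis. *)
Fixpoint ext_monomials e : seq (ext g) :=
  if e is v :: e' then
    ext_monomials e' ++ [seq ext_gen v * x | x <- ext_monomials e']
  else [:: 1].

(** Against the head generator of a product, [v] either squares to zero or anticommutes past it, and
    induction applies to the tail. *)
Lemma ext_monomials_mul e v a : v \in e ->
  lin_span (ext_monomials e) a -> lin_span (ext_monomials e) (ext_gen v * a).
Proof.
elim: e v a => [//|w e IH] v a /=; rewrite inE => ve.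
have lift r b : {subset r <= ext_monomials (w :: e)} -> lin_span r b ->
    lin_span (ext_monomials (w :: e)) b.
  by move=> rs; apply: (lin_span_map (f := idfun)) => // x /rs/lin_span_mem.
have mul_linear (u : g) : linear ( *%R (ext_gen u)).
  by move=> c x y; rewrite mulrDr -scalerAr.
apply: (lin_span_map (mul_linear v)) => x.
rewrite /= mem_cat => /orP[xe|/mapP[y ye ->]].
- have [<-|vw] := eqVneq v w.
    by apply/lin_span_mem; rewrite mem_cat map_f ?orbT.
  apply: (lift (ext_monomials e)) => [z ze|]; first by rewrite mem_cat ze.
  by apply: IH; [rewrite (negPf vw) in ve|exact: lin_span_mem].
- have [->|vw] := eqVneq v w.
    by rewrite mulrA ext_gen_sqr mul0r; exact: lin_span0.
  rewrite (negPf vw)/= in ve; rewrite mulrA ext_gen_anticomm mulNr -mulrA.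
  rewrite -scaleN1r; apply/lin_spanZ.
  apply: (lin_span_map (r := ext_monomials e) (mul_linear w)).
    by move=> z ze; apply/lin_span_mem; rewrite mem_cat map_f ?orbT.
  by apply: IH => //; exact: lin_span_mem.
Qed.

Lemma ext_finite_span : exists r, forall a, lin_span r a.
Proof.
pose e := vbasis {:g}; exists (ext_monomials e); elim/ext_monomial_ind.
  exact: lin_span0.
move=> c s a ra; apply: lin_spanD ra; apply: lin_spanZ => {c a}.
elim: s => [|v s IH].
  rewrite big_nil; elim: (e : seq g) => [|w r]; last rewrite /=.
    by apply: lin_span_mem; rewrite /= inE.
  move=> /(lin_span_map (f := idfun)); apply=> // x xr.
  by apply: lin_span_mem; rewrite mem_cat xr.
rewrite big_cons (coord_vbasis (memvf v)) linear_sum mulr_suml.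
apply: big_ind => [||i _]; [exact: lin_span0|exact: lin_spanD|].
rewrite /= [X in X * _](_ : _ =
    coord (vbasis {:g}) i v *: ext_gen (vbasis {:g})`_i).
  rewrite -scalerAl; apply: lin_spanZ; apply: ext_monomials_mul IH.
  by rewrite mem_nth// size_tuple.
exact: ext_genZ.
Qed.

(* A linear functional f on the exterior algebra is the pairing with the
   alternating form v1, ..., vn |-> f (v1 ∧ ... ∧ vn). *)
Lemma ext_pairing_inj a b :
  (forall X, ext_pairing X a = ext_pairing X b) -> a = b.
Proof.
move=> ab; apply/eqP; rewrite -subr_eq0; apply/negPn/negP.
have [r rV] := ext_finite_span.
move=> /(separating_functional rV)[f fl /negP]; apply; apply/eqP.
pose X := AltForm (ext_prod_alternating fl).
have fX c : f c = ext_pairing X c.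
  elim/ext_monomial_ind: c => [|d s c IH].
    by rewrite linear0 linear_fun0.
  by rewrite fl IH linearP/= ext_pairing_prod.
by rewrite fX linearB/= ab subrr.
Qed.

(** By the hypothesis monomials have transposed images, and these extend to all elements because
    monomials span. Forms separate points, so the transpose is unique and therefore linear. *)
Lemma ext_adjoint (T : altform g -> altform g) :
  (forall s, exists b, forall X, ext_pairing X b = T X s) ->
  exists T' : {linear ext g -> ext g},
    forall X a, ext_pairing (T X) a = ext_pairing X (T' a).
Proof.
move=> Ts.
have /choice[T' T'P] : forall a, exists b,
    forall X, ext_pairing (T X) a = ext_pairing X b.
  elim/ext_monomial_ind=> [|c s a [b ab]]; first by exists 0 => X;
    rewrite !linear0.
  have [d dP] := Ts s; exists (c *: d + b) => X.
  by rewrite !linearP/= ab ext_pairing_prod dP.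
have T'l : linear T'.
by move=> c a b; apply: ext_pairing_inj => X; rewrite linearP/= -!T'P linearP.
pose T'L := GRing.isLinear.Build K (ext g) (ext g) *:%R T' T'l.
by exists (HB.pack_for {linear ext g -> ext g} T' T'L).
Qed.

(** Too many arguments are linearly dependent: one of them lies in the span of the later ones, and
    expanding it repeats an argument in each term. *)
Lemma altform_large X s : (\dim {:g} < size s)%N -> X s = 0.
Proof.
move=> sd; have /asboolP[X1 X2] := altform_valP X.
have /existsP[i iX] : [exists i : 'I_(size s), s`_i \in <<drop i.+1 s>>%VS].
  rewrite -(freeNE (in_tuple s)); apply/negP => /=.
  rewrite /free => /eqP fs; move: sd; rewrite ltnNge -{1}fs.
  by rewrite dimvS// subvf.
rewrite -(cat_take_drop i s) (drop_nth 0)//.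
set p := take i s; set q := drop i.+1 s in iX *.
have X0 : X (p ++ 0 :: q) = 0.
  by have := X1 p q (-1) 0 0; rewrite scaler0 addr0 mulN1r addNr.
rewrite (coord_span (X := in_tuple q) iX).
rewrite (big_morph (fun v => X (p ++ v :: q)) (id1 := 0) (op1 := +%R)) //.
  apply: big1 => j _.
  have := X1 p q (coord (in_tuple q) j s`_i) (in_tuple q)`_j 0.
  rewrite addr0 X0 addr0 => ->.
  have /= jq := ltn_ord j.
  (* Naming the argument [u] lets [q] be split around its [j]-th entry without affecting the other
     copy. *)
  suff /(_ q`_j) -> : forall u, u = q`_j -> X (p ++ u :: q) = 0.
  - by rewrite mulr0.
  - by [].
  by move=> u uj; rewrite -(cat_take_drop j q) (drop_nth 0 jq) -uj X2.
by move=> u v /=; have := X1 p q 1 u v; rewrite scale1r mul1r.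
Qed.

End FiniteDimension.

(** * Cartan calculus on alternating forms *)

Section Forms.
Variables (K : fieldType) (g : lmodType K).
Implicit Types (X Y : altform g) (s : seq g).

Lemma altformP X Y : (forall s, X s = Y s) -> X = Y.
Proof. by move=> XY; apply/val_inj/funext. Qed.

Lemma altform_linear (c : K) X Y s : (c *: X + Y) s = c * X s + Y s.
Proof. by []. Qed.

Lemma altformD X Y s : (X + Y) s = X s + Y s. Proof. by []. Qed.

Lemma altformN X s : (- X) s = - X s. Proof. by []. Qed.

Lemma altform_swap X u v s : X [:: u, v & s] = - X [:: v, u & s].
Proof.
have := ext_pairing_prod X [:: u, v & s].
rewrite !big_cons mulrA ext_gen_anticomm mulNr linearN/= -mulrA => <-.
by rewrite -ext_pairing_prod !big_cons.
Qed.

Lemma altform_cons_linear X (c : K) u v s :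
  X (c *: u + v :: s) = c * X (u :: s) + X (v :: s).
Proof. by have /asboolP[X1 _] := altform_valP X; exact: (X1 [::]). Qed.

Lemma altform_cons0 X s : X (0 :: s) = 0.
Proof.
by have := altform_cons_linear X (-1) 0 0 s; rewrite scaler0 addr0 mulN1r addNr.
Qed.

Lemma altform_consN X v s : X (- v :: s) = - X (v :: s).
Proof.
have := altform_cons_linear X (-1) v 0 s.
by rewrite altform_cons0 !addr0 scaleN1r mulN1r.
Qed.

Lemma trunc_alternating n X :
  (fun s => if size s == n then X s else 0 : K^o) \in alternating (g:=g).
Proof.
have /asboolP[X1 X2] := altform_valP X.
apply/asboolP; split=> [s1 s2 c u v|s1 s2 s3 u].
  by rewrite !size_cat/=; case: ifP => _; rewrite ?X1// mulr0 addr0.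
by rewrite X2; case: ifP.
Qed.

(** The projection to arity [n], that is, to degree [n - 1] of the dgla. *)
Definition trunc n X : altform g := AltForm (trunc_alternating n X).

Lemma truncE n X s : trunc n X s = if size s == n then X s else 0.
Proof. by []. Qed.

Lemma trunc_linear n : linear (trunc n).
Proof.
move=> c X Y; apply: altformP => s; rewrite altform_linear !truncE.
by case: ifP => //; rewrite mulr0 addr0.
Qed.

End Forms.

(** * Lie derivatives and the square of the differential *)

Section CartanCalculus.
Variables (K : fieldType) (g : lieAlgebra K).
Implicit Types (X Y : altform g) (s : seq g) (u v w : g).

Lemma size_del2 s (m n : nat) : (m < n)%N -> (n < size s)%N ->
  (size (del m (del n s))).+2 = size s.
Proof.
move=> mn ns.
rewrite /del !size_cat !size_take !size_drop size_cat size_take size_drop ns.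
by case: ltnP; lia.
Qed.

Lemma CE_dE X s : CE_d X s = \sum_(j < size s) \sum_(i < j)
  (-1) ^+ (i + j) * X (lie_br s`_i s`_j :: del i (del j s)).
Proof. by []. Qed.

Lemma CE_d_linear : linear (@CE_d K g).
Proof.
move=> c X Y; apply: altformP => s; rewrite altform_linear !CE_dE.
rewrite mulr_sumr -big_split; apply: eq_bigr => j _ /=.
rewrite mulr_sumr -big_split; apply: eq_bigr => i _ /=.
by rewrite mulrDr mulrCA.
Qed.

HB.instance Definition _ := GRing.isLinear.Build K (altform g) (altform g) *:%R
  (@CE_d K g) CE_d_linear.

HB.instance Definition _ v := GRing.isLinear.Build K (altform g) (altform g)
  *:%R (contract v) (contract_linear v).

(* Cartan's formula, taken as the definition of the Lie derivative. *)
Definition lie_derivative v X : altform g :=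
  contract v (CE_d X) + CE_d (contract v X).

Lemma lie_derivative_linear v : linear (lie_derivative v).
Proof.
by move=> c X Y; rewrite /lie_derivative !linearP/= scalerDr addrACA.
Qed.

HB.instance Definition _ v := GRing.isLinear.Build K (altform g) (altform g)
  *:%R (lie_derivative v) (lie_derivative_linear v).

(** In [contract v (CE_d X)] the pairs containing [v] give this sum; the other pairs cancel against
    [CE_d (contract v X)]. *)
Lemma lie_derivativeE v X s : lie_derivative v X s =
  \sum_(j < size s) (-1) ^+ j.+1 * X (lie_br v s`_j :: del j s).
Proof.
rewrite altformD /contract /= /contract_fun /CE_fun /= big_ord_recl big_ord0.
rewrite add0r -big_split; apply: eq_bigr => j _ /=.
rewrite big_ord_recl /= -addrA -big_split big1 ?addr0 => [|i _] /=.
  by rewrite add0n /bump add1n /del /= drop0.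
rewrite /bump !add1n !add0n addSn addnS !exprS !mulN1r opprK.
rewrite (_ : del i.+1 _ = v :: del i (del j s))//.
by rewrite altform_swap mulrN addNr.
Qed.

Lemma contract_lie_derivative u v X : contract u (lie_derivative v X) =
  lie_derivative v (contract u X) - contract (lie_br v u) X.
Proof.
apply: altformP => s; rewrite altformD altformN lie_derivativeE.
rewrite [LHS]lie_derivativeE /= big_ord_recl /= /del /= drop0 mulN1r addrC.
congr (_ - _); apply: eq_bigr => j _; rewrite /contract_fun.
by rewrite altform_swap mulrN [in LHS]exprS mulN1r mulNr opprK.
Qed.

Lemma contract_CE_d v X :
  contract v (CE_d X) = lie_derivative v X - CE_d (contract v X).
Proof. by rewrite /lie_derivative addrK. Qed.

Lemma lie_brC u v : lie_br u v = - lie_br v u.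
Proof.
have [[brl brr] br0 _] := lie_brP g.
have := br0 (1 *: u + v); rewrite brl !brr !br0 /= !scale1r add0r addr0.
by move=> /eqP; rewrite addr_eq0 => /eqP.
Qed.

Lemma contractB u v X : contract (u - v) X = contract u X - contract v X.
Proof.
apply: altformP => s; rewrite altformD altformN.
rewrite addrC -scaleN1r [LHS]altform_cons_linear mulN1r addrC; exact: erefl.
Qed.

Lemma lie_jacobi_derivation u v w :
  lie_br (lie_br u v) w = lie_br u (lie_br v w) - lie_br v (lie_br u w).
Proof.
have [[_ brr] _ jac] := lie_brP g.
have brN (x y : g) : lie_br x (- y) = - lie_br x y.
  by have := brr x (-1) y 0; rewrite /= (linear_fun0 (brr x)) !addr0 !scaleN1r.
have := jac u v w; rewrite [lie_br w u]lie_brC brN => /eqP.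
by rewrite addr_eq0 [lie_br (lie_br u v) w]lie_brC => /eqP ->.
Qed.

(* Equality of forms is tested by contracting, by induction on the arity. *)
Lemma altform_op_ind (T : altform g -> altform g) :
  (forall X, T X [::] = 0) ->
  (forall v X, contract v (T X) = T (contract v X) \/
               contract v (T X) = - T (contract v X)) ->
  forall X, T X = 0.
Proof.
move=> T0 Tc X; apply: altformP => s; elim: s X => [//|v s IH] X.
rewrite -[T X (v :: s)]/(contract v (T X) s).
by have [->|->] := Tc v X; rewrite ?altformN IH ?oppr0.
Qed.

Local Opaque lie_derivative.

(** The difference of the two sides commutes with contractions, the extra terms cancelling by the
    Jacobi identity. *)
Lemma lie_derivative_br u v X : lie_derivative (lie_br u v) X =
  lie_derivative u (lie_derivative v X) - lie_derivative v (lie_derivative u X).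
Proof.
apply/eqP; rewrite -subr_eq0; apply/eqP; move: X.
apply: altform_op_ind => [X|w X].
  by rewrite !(lie_derivativeE, altformD, altformN) !big_ord0 !subr0.
left; rewrite !linearB/= !contract_lie_derivative !linearB/=.
rewrite lie_jacobi_derivation contractB.
apply: altformP => s; rewrite !(altformD, altformN); ring.
Qed.

(** The difference of the two sides anticommutes with contractions, by Cartan's formula and
    [lie_derivative_br]. *)
Lemma CE_d_lie_derivative v X :
  CE_d (lie_derivative v X) = lie_derivative v (CE_d X).
Proof.
apply/eqP; rewrite -subr_eq0; apply/eqP; move: X.
apply: altform_op_ind => [X|w X].
  by rewrite !(lie_derivativeE, CE_dE, altformD, altformN) !big_ord0 subr0.
right; rewrite !linearB/= contract_lie_derivative !contract_CE_d.
rewrite contract_lie_derivative !linearB/= lie_derivative_br.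
apply: altformP => s; rewrite !(altformD, altformN); ring.
Qed.

Lemma CE_d_square X : CE_d (CE_d X) = 0.
Proof.
move: X; apply: altform_op_ind => [X|v X]; first by rewrite CE_dE big_ord0.
left; rewrite contract_CE_d contract_CE_d linearB/= CE_d_lie_derivative.
by rewrite opprB addrCA subrr addr0.
Qed.

End CartanCalculus.

(** * Gradings *)

Section Grading.
Variables (K : fieldType).

(** The map [pr k] projects onto degree [k - c]; the shift [c] is 1 for forms and 0 for the exterior
    algebra. Degrees below [- c] are zero, as every projection kills them. *)
Lemma graded_of_projections (V : graded_space K) (c : int) (N : nat)
    (pr : nat -> {linear V -> V}) :
  (forall i, deg V i 0) ->
  (forall i (k : K) (x y : V), deg V i x -> deg V i y -> deg V i (k *: x + y)) ->
  (forall k x, deg V (k%:Z - c) (pr k x)) ->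
  (forall k x, deg V (k%:Z - c) x -> pr k x = x) ->
  (forall i k x, deg V i x -> i != k%:Z - c -> pr k x = 0) ->
  (forall x, x = \sum_(k < N) pr k x) -> is_graded V.
Proof.
move=> deg0 degP pr_deg pr_id pr0 pr_sum; split=> // x.
pose f i := if i + c is Posz k then pr k x else 0.
have fE k : f (k%:Z - c) = pr k x by rewrite /f subrK.
have f_deg i : deg V i (f i).
  rewrite /f; case ic : (i + c) => [k|k] //.
  by rewrite -[i](addrK c) ic; exact: pr_deg.
have pr_large k : (N <= k)%N -> pr k x = 0.
  move=> Nk; rewrite [x]pr_sum linear_sum big1// => l _.
  apply: (pr0 (l%:Z - c)) => //.
  rewrite (inj_eq (addIr _)) eqz_nat; apply: contraTneq Nk => <-.
  by rewrite -ltnNge.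
pose r : seq int := [seq k%:Z - c | k <- index_iota 0 N].
have f_supp i : i \notin r -> f i = 0.
  rewrite /f; case ic : (i + c) => [k|k] // ir; apply: pr_large.
  rewrite leqNgt; apply: contra ir => kN; apply/mapP; exists k.
    by rewrite mem_index_iota.
  by rewrite -ic addrK.
exists f; split; first split=> //.
- apply: (sub_finite_set _ (finite_seq r)) => i /= fi0.
  by apply: contraNT fi0 => /f_supp ->.
- rewrite (fsbigE r) //; last by move=> i _; exact: f_supp.
    rewrite [LHS]pr_sum big_map big_mkord.
    by apply: eq_big => k; rewrite ?in_setT ?fE.
  by rewrite map_inj_uniq ?iota_uniq// => k l /addIr[].
move=> f' [f'_deg f'_fin f'_sum]; apply/funext => i.
have [r' r'P] : exists r' : seq int,
    [set i | f' i != 0]%classic = [set` r']%classic.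
  exact/finite_seqP.
(* Uniqueness: applying [pr k] to any other decomposition isolates its component of degree
   [k - c]. *)
have pr_f' k : pr k x = f' (k%:Z - c).
  have xr' : x = \sum_(j <- undup r') f' j.
    rewrite f'_sum (fsbigE (undup r')) ?undup_uniq//.
      by apply: eq_bigl => j; rewrite in_setT.
    move=> j _; rewrite mem_undup => jr'; apply/eqP/negPn/negP => fj0.
    have : [set i | f' i != 0]%classic j by [].
    by rewrite r'P /=; exact/negP.
  have pr_ne j : j != k%:Z - c -> pr k (f' j) = 0 by exact: pr0.
  rewrite xr' linear_sum; have [kr|kr] := boolP (k%:Z - c \in undup r').
    rewrite (bigD1_seq _ kr) ?undup_uniq//= pr_id// big1 => [|j /pr_ne//].
    exact: addr0.
  rewrite big1_seq => [|j /= jr].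
    apply/esym/eqP/negPn/negP => fk0.
    have : [set i | f' i != 0]%classic (k%:Z - c) by [].
    by rewrite r'P /= -mem_undup; exact/negP.
  by apply: pr_ne; apply: contraTneq jr => ->.
rewrite /f; case ic : (i + c) => [k|k].
  by rewrite pr_f' -ic addrK.
rewrite [f' i]pr_sum big1// => l _; apply: pr0 (f'_deg i) _.
by apply/eqP => il; move: ic; rewrite il subrK.
Qed.

End Grading.

(** * The dgla of forms, graded by arity *)

Section FormsGraded.
Variables (K : fieldType) (g : lieAlgebra K).

HB.instance Definition _ n := GRing.isLinear.Build K (altform g) (altform g)
  *:%R (trunc n) (@trunc_linear K g n).

(** The sum may stop at the dimension of [g] by [altform_large]. *)
Lemma altform_trunc_sum (X : altform g) :
  X = \sum_(k < (\dim {:g}).+1) trunc k X.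
Proof.
apply: altformP => s.
rewrite (big_morph (fun Y : altform g => Y s) (id1 := 0) (op1 := +%R)) //.
rewrite (eq_bigr (fun k : 'I_ _ => if k == size s :> nat then X s else 0)).
  rewrite -big_mkcond; have [sd|sd] := ltnP (size s) (\dim {:g}).+1.
    by rewrite (big_pred1 (Ordinal sd)).
  by rewrite altform_large// big1.
by move=> k _; rewrite truncE eq_sym.
Qed.

Lemma CE_degE i (X : altform g) : deg (CE_dgla g) i X =
  (forall s : seq g, (size s)%:Z != i + 1 -> X s = 0).
Proof. by []. Qed.

Lemma CE_graded : is_graded (CE_dgla g).
Proof.
apply: (@graded_of_projections _ (CE_dgla g) 1 (\dim {:g}).+1
  (fun k => trunc k : {linear altform g -> altform g})) => /=.
- by [].
- move=> i k X Y Xi Yi s si.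
  by rewrite [LHS]altform_linear Xi// Yi// mulr0 addr0.
- by move=> k X s /=; rewrite subrK eqz_nat => /negPf ->.
- move=> k X /= Xk; apply: altformP => s; rewrite truncE; case: eqP => // /eqP sk.
  by rewrite Xk// subrK eqz_nat.
- move=> i k X Xi ik; apply: altformP => s; rewrite truncE.
  case: eqP => // sk; rewrite Xi// sk; apply: contra ik => /eqP ->.
  by rewrite addrK.
- exact: altform_trunc_sum.
Qed.

Lemma CE_d_deg i (X : altform g) :
  deg (CE_dgla g) i X -> deg (CE_dgla g) (i + 1) (CE_d X).
Proof.
rewrite !CE_degE => Xi s si; rewrite CE_dE big1 // => j _; rewrite big1// => k _.
rewrite Xi ?mulr0//; apply: contra si => /eqP <-.
have /(congr1 Posz) <- := size_del2 (ltn_ord k) (ltn_ord j).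
by rewrite -addn1.
Qed.

Lemma CE_is_dgla : is_dgla (CE_dgla g).
Proof.
have deg0 i : deg (CE_dgla g) i 0 by [].
split => /=.
- exact: CE_graded.
- exact: CE_d_linear.
- exact: CE_d_deg.
- exact: CE_d_square.
- split=> //= [i|i j x y _ _|i j l x y z _ _ _].
  + by split=> u c x y /=; rewrite scaler0 addr0.
  + by rewrite scaler0 oppr0.
  + by rewrite scaler0 addr0.
- by move=> i x y _; rewrite linear0 scaler0 addr0.
Qed.

End FormsGraded.

(** * The exterior algebra as a graded commutative algebra *)

Section ExteriorGraded.
Variables (K : fieldType) (g : lieAlgebra K).
Local Notation B := (exterior_algebra g).
Implicit Types (a b c : ext g).

Lemma ext_deg0 i : deg B i 0.
Proof.
by exists 0%N, (fun=> 0), (fun=> [::]); split=> [[]//|]; rewrite big_ord0.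
Qed.

Lemma ext_deg_linear i (k : K) a b :
  deg B i a -> deg B i b -> deg B i (k *: a + b).
Proof.
move=> [m [c [v [vi ->]]]] [n [d [w [wi ->]]]].
exists (m + n)%N,
  (fun j => match fintype.split j with inl j => k * c j | inr j => d j end).
exists (fun j => match fintype.split j with inl j => v j | inr j => w j end).
split=> [j|]; first by case: fintype.split.
rewrite big_split_ord /= scaler_sumr; congr (_ + _); apply: eq_bigr => j _.
  by rewrite (unsplitK (inl j)) scalerA.
by rewrite (unsplitK (inr j)).
Qed.

Lemma ext_degD i a b : deg B i a -> deg B i b -> deg B i (a + b).
Proof. by move=> ai; rewrite -[a]scale1r; exact: ext_deg_linear. Qed.

Lemma ext_degZ i k a : deg B i a -> deg B i (k *: a).
Proof.
by move=> ai; rewrite -[_ *: _]addr0; apply: ext_deg_linear => //; exact: ext_deg0.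
Qed.

Lemma ext_degB i a b : deg B i a -> deg B i b -> deg B i (a - b).
Proof.
by move=> ai bi; rewrite -scaleN1r; apply: ext_degD => //; exact: ext_degZ.
Qed.

Lemma ext_deg_prod s : deg B (size s)%:Z (ext_prod s).
Proof.
by exists 1%N, (fun=> 1), (fun=> s); split=> //; rewrite big_ord1 scale1r.
Qed.

Lemma ext_deg_ind i (P : ext g -> Prop) : P 0 ->
  (forall k s a, (size s)%:Z = i -> P a -> P (k *: ext_prod s + a)) ->
  forall a, deg B i a -> P a.
Proof.
move=> P0 PD a [m [c [v [vi ->]]]].
by elim/big_rec: _ => // j b _; exact: PD.
Qed.

Lemma ext_deg_mul i j a b : deg B i a -> deg B j b -> deg B (i + j) (a * b).
Proof.
move=> ai bj; move: a ai; apply: ext_deg_ind.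
  by rewrite mul0r; exact: ext_deg0.
move=> k s a si aij; rewrite mulrDl -scalerAl; apply: ext_deg_linear => //.
move: b bj {aij}; apply: ext_deg_ind; first by rewrite mulr0; exact: ext_deg0.
move=> l t b tj bij; rewrite mulrDr -scalerAr; apply: ext_deg_linear => //.
rewrite -big_cat -si -tj -PoszD -size_cat; exact: ext_deg_prod.
Qed.

Lemma ext_mulC i j a b : deg B i a -> deg B j b ->
  a * b = (-1 : K) ^ (i * j) *: (b * a).
Proof.
move=> ai bj; move: a ai; apply: ext_deg_ind.
  by rewrite mul0r mulr0 scaler0.
move=> k s a si ab; rewrite mulrDl mulrDr scalerDr ab; congr (_ + _).
rewrite -scalerAl -scalerAr; move: b bj {ab}; apply: ext_deg_ind.
  by rewrite mul0r mulr0 !scaler0.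
move=> l t b tj; rewrite mulrDl mulrDr !scalerDr => ->; congr (_ + _).
rewrite -scalerAl -scalerAr ext_prodC -si -tj -PoszM -exprnP.
by rewrite !scalerA; congr (_ *: _); ring.
Qed.

Lemma ext_is_gca : is_gca B.
Proof.
split.
(* The degree projections of the exterior algebra are the transposes of the truncations of forms, so
   that they need not be defined on representatives. *)
- have /choice[pr prP] k : exists T' : {linear ext g -> ext g},
      forall X a, ext_pairing (trunc k X) a = ext_pairing X (T' a).
    apply: ext_adjoint => s; exists (if size s == k then ext_prod s else 0) => X.
    rewrite truncE; case: ifP => _; first exact: ext_pairing_prod.
    by rewrite linear0.
  have pr_prod k s : pr k (ext_prod s) = if size s == k then ext_prod s else 0.
    apply: ext_pairing_inj => X; rewrite -prP ext_pairing_prod truncE.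
    by case: ifP => _; rewrite ?linear0 ?ext_pairing_prod.
  apply: (@graded_of_projections _ B 0 (\dim {:g}).+1 pr).
  + exact: ext_deg0.
  + exact: ext_deg_linear.
  + move=> k x; rewrite subr0; elim/ext_monomial_ind: x.
      by rewrite linear0; exact: ext_deg0.
    move=> c s a ak; rewrite linearP/= pr_prod; apply: ext_deg_linear ak.
    case: eqP => [<-|_]; [exact: ext_deg_prod|exact: ext_deg0].
  + move=> k; rewrite subr0; apply: ext_deg_ind; first by rewrite linear0.
    by move=> c s a [sk] ak; rewrite linearP/= ak pr_prod sk eqxx.
  + move=> i k x xi; rewrite subr0 => ik; move: x xi; apply: ext_deg_ind.
      by rewrite linear0.
    move=> c s a si ak; rewrite linearP/= ak pr_prod -eqz_nat si (negPf ik).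
    by rewrite scaler0 addr0.
  + move=> a; apply: ext_pairing_inj => X; rewrite linear_sum /=.
    under eq_bigr do rewrite -prP.
    rewrite {1}[X]altform_trunc_sum.
    apply: (big_morph (fun Y => ext_pairing Y a)) => [Y Z|].
      exact: ext_pairingDl.
    exact: ext_pairing0l.
- split=> [b|a] k x y /=; first by rewrite mulrDl -scalerAl.
  by rewrite mulrDr -scalerAr.
- exact: ext_deg_mul.
- exact: mulrA.
- exact: ext_mulC.
Qed.

End ExteriorGraded.

(** * Derived bracket of a second-order operator *)

Section Signs.
Variable K : fieldType.
Implicit Types i j : int.

(** With this, an identity involving signs splits into cases that [ring] decides. *)
Lemma sign_cases i : (-1 : K) ^ i = 1 \/ (-1 : K) ^ i = -1.
Proof.
by case: i => n; rewrite /exprz -signr_odd; case: odd;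
  rewrite ?expr0 ?expr1 ?invrN ?invr1; [right|left|right|left].
Qed.

Lemma signD i j : (-1 : K) ^ (i + j) = (-1) ^ i * (-1) ^ j.
Proof. by rewrite expfzDr// oppr_eq0 oner_eq0. Qed.

Lemma signN i : (-1 : K) ^ (- i) = (-1) ^ i.
Proof.
have := signD i (- i); rewrite subrr expr0z.
by have [->|->] := sign_cases i; rewrite ?mulN1r ?mul1r => /esym// /eqP;
  rewrite eqr_oppLR => /eqP.
Qed.

Lemma sign1 : (-1 : K) ^ (1 : int) = -1. Proof. by []. Qed.

End Signs.

Section SecondOrderOperators.
Variables (K : fieldType) (A : algType K) (delta : {linear A -> A}).
Implicit Types (a b c s t u v w : A) (e : K).

Hypothesis separated : forall a b,
  (forall f : {linear A -> K | *%R}, f a = f b) -> a = b.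

Let funD (f : {linear A -> K | *%R}) x y : f (x + y) = f x + f y.
Proof. exact: linearD. Qed.
Let funN (f : {linear A -> K | *%R}) x : f (- x) = - f x.
Proof. exact: linearN. Qed.
Let funZ (f : {linear A -> K | *%R}) k x : f (k *: x) = k * f x.
Proof. exact: linearZ. Qed.
Let deltaD x y : delta (x + y) = delta x + delta y.
Proof. exact: linearD. Qed.
Let deltaN x : delta (- x) = - delta x.
Proof. exact: linearN. Qed.
Let deltaZ k x : delta (k *: x) = k *: delta x.
Proof. exact: linearZ. Qed.

(* An identity between elements of A is tested against all linear forms, which
   turns it into a commutative polynomial identity in K. *)
Local Ltac alg_linear :=
  apply: separated => ?;
  rewrite ?(deltaD, deltaN, deltaZ, mulrDl, mulrDr, mulNr, mulrN, mulrA,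
    scalerDr, scalerN, =^~ scalerAl, =^~ scalerAr, funD, funN, funZ).


(* When v is a generator of an exterior algebra and delta its codifferential,
   this is minus the adjoint action of v. *)
Definition delta_ad v a := delta (v * a) + v * delta a.

(* The failure of delta to be a derivation, e being the sign of a. *)
Definition delta_defect e a b :=
  delta (a * b) - delta a * b - e *: (a * delta b).

Local Notation theta := delta_ad.
Local Notation Phi := delta_defect.

(** Induction step showing that [theta v] is a derivation; [w] stands for the Lie bracket of [v]
    with the generator [u]. *)
Lemma delta_adM v u w s b :
  (forall a, theta v (u * a) = u * theta v a - w * a) ->
  theta v (s * b) = theta v s * b + s * theta v b ->
  theta v (u * s * b) = theta v (u * s) * b + u * s * theta v b.
Proof.
move=> uP sP; rewrite -mulrA !uP sP; move: (theta v s) (theta v b) => x y.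
by alg_linear; ring.
Qed.

Lemma delta_defectM e v s b :
  theta v (s * b) = theta v s * b + s * theta v b ->
  Phi (- e) (v * s) b = s * theta v b - v * Phi e s b.
Proof.
(* Moving [delta] past [v] costs [theta v]. The sign of [v * s] is [- e] since [v] is odd. *)
have deltaM a : delta (v * a) = theta v a - v * delta a.
  by rewrite /theta addrK.
move=> sP; rewrite /Phi -[_ * _ * b]mulrA !deltaM sP.
by alg_linear; ring.
Qed.

Lemma delta_defect_step e v s t c k l :
  (forall b, theta v (s * b) = theta v s * b + s * theta v b) ->
  theta v (t * c) = theta v t * c + t * theta v c ->
  v * t = k *: (t * v) -> s * t = (l * k) *: (t * s) ->
  Phi e s (t * c) = Phi e s t * c + l *: (t * Phi e s c) ->
  Phi (- e) (v * s) (t * c) =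
    Phi (- e) (v * s) t * c + (l * k) *: (t * Phi (- e) (v * s) c).
Proof.
move=> sP tP vt st IH; rewrite !delta_defectM// IH tP.
move: (theta v t) (theta v c) (Phi e s t) (Phi e s c) => x y z r.
have vtr : v * (t * r) = k *: (t * (v * r)) by rewrite mulrA vt -scalerAl mulrA.
have sty : s * (t * y) = (l * k) *: (t * (s * y)).
  by rewrite mulrA st -scalerAl mulrA.
rewrite !mulrDr !mulrN -!scalerAr vtr sty.
by alg_linear; ring.
Qed.

Lemma delta_defect_linearl e b : linear ((Phi e)^~ b).
Proof. by move=> k x y; rewrite /Phi; alg_linear; ring. Qed.

Lemma delta_defect_linearr e a : linear (Phi e a).
Proof. by move=> k x y; rewrite /Phi; alg_linear; ring. Qed.

(** * Order two and the graded Lie axioms *)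

Section Graded.
Variable dg : int -> set A.
Implicit Types i j l : int.

Hypothesis dgZ : forall i k a, dg i a -> dg i (k *: a).
Hypothesis dgB : forall i a b, dg i a -> dg i b -> dg i (a - b).
Hypothesis dgM : forall i j a b, dg i a -> dg j b -> dg (i + j) (a * b).
Hypothesis dgC : forall i j a b, dg i a -> dg j b ->
  a * b = (-1 : K) ^ (i * j) *: (b * a).
Hypothesis delta_dg : forall i a, dg i a -> dg (i - 1) (delta a).
Hypothesis delta_sqr : forall a, delta (delta a) = 0.
Hypothesis defect_derivation : forall i j a b c, dg i a -> dg j b ->
  Phi ((-1) ^ i) a (b * c) =
  Phi ((-1) ^ i) a b * c + (-1 : K) ^ ((i + 1) * j) *: (b * Phi ((-1) ^ i) a c).

(** Exponents are expanded until only the signs with exponents [i], [j] and [i * j] remain; treating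
    these as independent leaves eight cases. *)
Local Ltac sign_split i j :=
  rewrite ?(mulrDl, mulrDr, mulN1r, mulrN1, mul1r, mulr1) ?(signD, signN) ?sign1;
  move: (sign_cases K i) (sign_cases K j) (sign_cases K (i * j));
  move: ((-1 : K) ^ i) ((-1 : K) ^ j) ((-1 : K) ^ (i * j)).

(** This is the derivation property of the defect of [a], written out, with [b] commuted past [a]
    and [delta a]. *)
Lemma delta_second_order i j a b c : dg i a -> dg j b ->
  delta (a * b * c) - delta (a * b) * c + delta a * b * c
    - (-1 : K) ^ i *: (a * delta (b * c))
    - (-1 : K) ^ ((i + 1) * j) *: (b * delta (a * c))
    + (-1 : K) ^ i *: (a * delta b * c)
    + (-1 : K) ^ (i + j) *: (a * b * delta c) = 0.
Proof.
move=> ai bj; have /eqP := defect_derivation c ai bj.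
rewrite -subr_eq0 => /eqP <-; rewrite /Phi.
have dC : b * delta a = (-1 : K) ^ ((i - 1) * j) *: (delta a * b).
  by rewrite (dgC bj (delta_dg ai)) mulrC.
have aC : b * a = (-1 : K) ^ (i * j) *: (a * b) by rewrite (dgC bj ai) mulrC.
rewrite !(mulrBr, mulrBl) -!scalerAr -!scalerAl !mulrA dC aC.
alg_linear; sign_split i j.
by move=> ? ? ? [->|->] [->|->] [->|->]; ring.
Qed.

Lemma delta_defect_dg i j a b e :
  dg i a -> dg j b -> dg (i + j - 1) (Phi e a b).
Proof.
move=> ai bj; rewrite /Phi; apply: dgB; first apply: dgB.
- exact/delta_dg/dgM.
- by rewrite addrAC; apply: dgM => //; exact: delta_dg.
- by rewrite -addrA; apply/dgZ/dgM => //; exact: delta_dg.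
Qed.

Lemma delta_defectC i j a b : dg i a -> dg j b ->
  Phi ((-1) ^ i) a b = (-1 : K) ^ (i * j) *: Phi ((-1) ^ j) b a.
Proof.
move=> ai bj; rewrite /Phi (dgC ai bj) (dgC (delta_dg ai) bj).
rewrite (dgC ai (delta_dg bj)).
alg_linear; sign_split i j.
by move=> ? ? ? [->|->] [->|->] [->|->]; ring.
Qed.

(** Since [delta] squares to zero, it is, up to sign, a derivation of the bracket that it
    generates. *)
Lemma delta_defect_delta i a b : Phi ((-1) ^ i) a (delta b) =
  - (-1 : K) ^ i *: (delta (Phi ((-1) ^ i) a b) + Phi ((-1) ^ (i - 1)) (delta a) b).
Proof.
rewrite /Phi signD signN sign1.
alg_linear; rewrite !delta_sqr !(mul0r, mulr0, linear0).
by have [->|->] := sign_cases K i; ring.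
Qed.

(* The operator Phi a is the graded commutator of delta with the multiplication
   by a, up to a multiplication operator: so its commutator with the derivation
   Phi b is computed by Jacobi and delta^2 = 0. *)
Lemma delta_defect_commutator i j a b c : dg i a -> dg j b ->
  Phi ((-1) ^ i) a (Phi ((-1) ^ j) b c) =
    - (-1 : K) ^ i *: Phi ((-1) ^ (i + j - 1)) (Phi ((-1) ^ i) a b) c +
    (-1 : K) ^ ((i - 1) * (j - 1)) *: Phi ((-1) ^ j) b (Phi ((-1) ^ i) a c).
Proof.
move=> ai bj; have PhiB e x y z : Phi e x (y - z) = Phi e x y - Phi e x z.
  by rewrite /Phi; alg_linear; ring.
have PhiZ e k x y : Phi e x (k *: y) = k *: Phi e x y.
  by rewrite /Phi; alg_linear; ring.
(* The inner defect is expanded; [Phi a] then passes through [delta] by [delta_defect_delta] and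
   through products as a derivation. *)
rewrite {1}[Phi _ b c]/Phi ![in LHS]PhiB [in LHS]PhiZ.
rewrite [in LHS]delta_defect_delta ![in LHS](defect_derivation _ ai bj).
rewrite [in LHS](defect_derivation _ ai (delta_dg bj)).
rewrite [in LHS](defect_derivation _ (delta_dg ai) bj).
rewrite ![in LHS]delta_defect_delta.
move: (Phi _ a b) (Phi _ a c) (Phi _ (delta a) b) (Phi _ (delta a) c).
move=> Pab Pac Pdab Pdac; rewrite /Phi.
alg_linear; sign_split i j.
by move=> ? ? ? [->|->] [->|->] [->|->]; ring.
Qed.

(** Antisymmetry comes from graded commutativity through [delta_defectC], and the Jacobi identity is
    [delta_defect_commutator]. *)
Lemma derived_bracket_lie : is_graded_lie (fun i => dg (i + 1))
  (fun i a b => (-1 : K) ^ (i + 1) *: Phi ((-1) ^ (i + 1)) a b).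
Proof.
have PhiZ e k x y : Phi e x (k *: y) = k *: Phi e x y.
  by rewrite /Phi; alg_linear; ring.
have PhiZl e k x y : Phi e (k *: x) y = k *: Phi e x y.
  by rewrite /Phi; alg_linear; ring.
split.
- by move=> i; split=> [b|a] k x y /=;
    rewrite (delta_defect_linearl, delta_defect_linearr) scalerDr !scalerA
      [k * _]mulrC.
- move=> i j a b ai bj; apply: dgZ.
  by have := delta_defect_dg ((-1) ^ (i + 1)) ai bj; rewrite addrACA addrA addrK.
- move=> i j a b ai bj; rewrite (delta_defectC ai bj).
  alg_linear; sign_split i j.
  by move=> ? ? ? [->|->] [->|->] [->|->]; ring.
- move=> i j l a b c ai bj _.
  (* The unshifted degree of the bracket of elements of degrees [i + 1] and [j + 1]. *)
  have -> : i + j + 1 = (i + 1) + (j + 1) - 1 by ring.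
  rewrite !PhiZ PhiZl (delta_defect_commutator c ai bj) !addrK.
  move: (Phi _ (Phi _ a b) c) (Phi _ b (Phi _ a c)) => x y.
  alg_linear; sign_split i j.
  by move=> ? ? ? [->|->] [->|->] [->|->]; ring.
Qed.

End Graded.
End SecondOrderOperators.

(** * The codifferential of the exterior algebra *)

Section Codifferential.
Variables (K : fieldType) (g : lieAlgebra K).
Local Notation B := (exterior_algebra g).
Implicit Types (a b c : ext g) (X : altform g) (i j l : int) (s t : seq g).

(** The boundary of Lie algebra homology on a monomial, as a function of the list [s]; that it
    descends to the algebra follows from [ext_adjoint]. *)
Let boundary s : ext g := \sum_(j < size s) \sum_(i < j)
  (-1) ^+ (i + j) *: ext_prod (lie_br s`_i s`_j :: del i (del j s)).

Let boundaryP s X : ext_pairing X (boundary s) = CE_d X s.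
Proof.
rewrite linear_sum CE_dE; apply: eq_bigr => j _.
rewrite linear_sum; apply: eq_bigr => i _.
by rewrite linearZ /= ext_pairing_prod.
Qed.

Lemma ext_codifferential : exists delta : {linear ext g -> ext g},
  forall X a, ext_pairing (CE_d X) a = ext_pairing X (delta a).
Proof. by apply: ext_adjoint => s; exists (boundary s) => X. Qed.

Variable delta : {linear ext g -> ext g}.
Hypothesis deltaP : forall X a,
  ext_pairing (CE_d X) a = ext_pairing X (delta a).

Lemma delta_prod s : delta (ext_prod s) = \sum_(j < size s) \sum_(i < j)
  (-1) ^+ (i + j) *: ext_prod (lie_br s`_i s`_j :: del i (del j s)).
Proof.
apply: ext_pairing_inj => X.
by rewrite -deltaP ext_pairing_prod -boundaryP.
Qed.

Lemma delta_deg i a : deg B i a -> deg B (i - 1) (delta a).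
Proof.
move: a; apply: ext_deg_ind; first by rewrite linear0; exact: ext_deg0.
move=> k s a si ai; rewrite linearP; apply: ext_deg_linear ai.
rewrite delta_prod.
elim/big_ind: _ => [||j _]; [exact: ext_deg0|exact: ext_degD|].
elim/big_ind: _ => [||m _]; [exact: ext_deg0|exact: ext_degD|].
apply: ext_degZ; have -> : i - 1 = (size (lie_br s`_m s`_j :: del m (del j s)))%:Z.
  have := size_del2 (ltn_ord m) (ltn_ord j).
  by move=> /(congr1 Posz); rewrite si => <-; rewrite -addn1 PoszD addrK.
exact: ext_deg_prod.
Qed.

Lemma delta_square a : delta (delta a) = 0.
Proof.
by apply: ext_pairing_inj => X; rewrite -!deltaP CE_d_square ext_pairing0l linear0.
Qed.

Lemma ext_separated a b :
  (forall f : {linear ext g -> K | *%R}, f a = f b) -> a = b.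
Proof. by move=> ab; apply: ext_pairing_inj => X; exact: ab. Qed.

Lemma delta_adP v X a :
  ext_pairing (lie_derivative v X) a = ext_pairing X (delta_ad delta (ext_gen v) a).
Proof.
rewrite /lie_derivative ext_pairingDl linearD/= -!deltaP !ext_pairing_genM.
by rewrite deltaP.
Qed.

Lemma delta_ad1 v : delta_ad delta (ext_gen v) 1 = 0.
Proof.
apply: ext_pairing_inj => X; rewrite -delta_adP linear0.
have := ext_pairing_prod (lie_derivative v X) [::].
by rewrite big_nil lie_derivativeE big_ord0.
Qed.

Lemma delta_ad_genM u v a : delta_ad delta (ext_gen v) (ext_gen u * a) =
  ext_gen u * delta_ad delta (ext_gen v) a - ext_gen (lie_br v u) * a.
Proof.
apply: ext_pairing_inj => X.
rewrite -delta_adP linearB/= !ext_pairing_genM contract_lie_derivative.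
by rewrite ext_pairingBl delta_adP.
Qed.

Lemma delta_ad_prodM v s b : delta_ad delta (ext_gen v) (ext_prod s * b) =
  delta_ad delta (ext_gen v) (ext_prod s) * b +
  ext_prod s * delta_ad delta (ext_gen v) b.
Proof.
elim: s b => [|u s IH] b; first by rewrite big_nil delta_ad1 !mul1r mul0r add0r.
rewrite big_cons; apply: delta_adM (IH b); first exact: ext_separated.
by move=> a; exact: delta_ad_genM.
Qed.

Lemma delta_defect1 b : delta_defect delta 1 1 b = 0.
Proof.
have d1 : delta 1 = 0 by have := delta_prod [::]; rewrite big_nil big_ord0.
by rewrite /delta_defect d1 mul0r subr0 !mul1r scale1r subrr.
Qed.

Lemma delta_defect_prod s t c :
  delta_defect delta ((-1) ^+ size s) (ext_prod s) (ext_prod t * c) =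
  delta_defect delta ((-1) ^+ size s) (ext_prod s) (ext_prod t) * c +
  (-1) ^+ ((size s).+1 * size t) *:
    (ext_prod t * delta_defect delta ((-1) ^+ size s) (ext_prod s) c).
Proof.
elim: s => [|v s IH].
  by rewrite big_nil !delta_defect1 mul0r mulr0 scaler0 addr0.
(* The sign is factored as [l * k] with [k = (-1) ^+ size t], the form required by
   [delta_defect_step]. *)
rewrite big_cons [size (v :: s)]/= exprS mulN1r mulSn addnC exprD.
apply: delta_defect_step IH.
- exact: ext_separated.
- exact: delta_ad_prodM.
- exact: delta_ad_prodM.
- exact: ext_gen_prodC.
- by rewrite ext_prodC mulSn addnC exprD -mulrA -expr2 sqrr_sign mulr1.
Qed.

Lemma delta_defect_derivation i j a b c : deg B i a -> deg B j b ->
  delta_defect delta ((-1) ^ i) a (b * c) =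
  delta_defect delta ((-1) ^ i) a b * c +
  (-1 : K) ^ ((i + 1) * j) *: (b * delta_defect delta ((-1) ^ i) a c).
Proof.
have linl e x : linear ((delta_defect delta e)^~ x).
  by apply: delta_defect_linearl; exact: ext_separated.
have linr e x : linear (delta_defect delta e x).
  by apply: delta_defect_linearr; exact: ext_separated.
(* From here on only linearity in each argument and the case of monomials [a] and [b] matter. *)
move: (delta_defect delta) linl linr delta_defect_prod => Phi linl linr Phi_prod.
move=> ai bj; move: a ai; apply: ext_deg_ind.
  by rewrite !(linear_fun0 (linl _ _)) mul0r mulr0 scaler0 addr0.
move=> k s a si aP; rewrite !linl aP.
rewrite [X in _ = X + _]mulrDl mulrDr scalerDr [RHS]addrACA.
congr (_ + _); rewrite -scalerAl -scalerAr scalerA mulrC -scalerA -scalerDr.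
congr (_ *: _); rewrite -si; move: b bj {aP}; apply: ext_deg_ind.
  by rewrite mul0r !(linear_fun0 (linr _ _)) !mul0r scaler0 addr0.
move=> l t b tj bP; rewrite mulrDl -scalerAl !linr bP.
rewrite [X in _ = X + _]mulrDl [X in _ = _ + _ *: X]mulrDl scalerDr [RHS]addrACA.
congr (_ + _); rewrite -!scalerAl scalerA [_ * l]mulrC -scalerA -scalerDr.
by congr (_ *: _); rewrite -tj -PoszD -PoszM addn1; exact: Phi_prod.
Qed.

Lemma ext_is_BV : @is_BV K B delta.
Proof.
split.
- exact: ext_is_gca.
- exact: linearP.
- exact: delta_deg.
- exact: delta_square.
- apply: (derived_bracket_lie ext_separated (dg := deg B)).
  + exact: ext_degZ.
  + exact: ext_degB.
  + exact: ext_deg_mul.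
  + exact: ext_mulC.
  + exact: delta_deg.
  + exact: delta_square.
  + exact: delta_defect_derivation.
- move=> i j l a b c ai bj _.
  apply: (delta_second_order ext_separated (dg := deg B)) => //.
  + exact: ext_mulC.
  + exact: delta_deg.
  + exact: delta_defect_derivation.
Qed.

End Codifferential.

(** * The MCP structure and central extensions *)

Section CentralExtensions.
Variables (K : fieldType) (g : lieAlgebra K).
Implicit Types (X : altform g) (i : int).

Lemma MC_CE : MC (CE_dgla g) = cocycles2 g.
Proof.
apply/seteqP; split=> X /= [].
  by move=> X2; rewrite scaler0 addr0 => dX; split.
by move=> dX X2; split=> //; rewrite scaler0 addr0.
Qed.

Lemma CE_MCP : is_MCP (CE_dgla g) (exterior_algebra g) ext_pairing.
Proof.
split.
- exact: CE_is_dgla.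
- exact: ext_is_gca.
- split=> [b|X]; [exact: ext_pairing_linearl|exact: ext_pairing_is_linear].
- move=> i X Xi Xb; apply: altformP => s.
  have [si|si] := eqVneq (size s)%:Z (i + 1); last by rewrite Xi.
  by rewrite -ext_pairing_prod; apply: Xb; rewrite -si; exact: ext_deg_prod.
- move=> i b bi bX; apply: ext_pairing_inj => X; rewrite linear0.
  (* No monomial has negative degree, so [b] is 0 there; in degree [n], pairing with [b] sees only
     the component of arity [n] of a form. *)
  case ni : (i + 1) bi => [n|n] bi; last first.
    by move: b bi {bX}; apply: ext_deg_ind => //; exact: linear0.
  rewrite -(bX (trunc n X)); last first.
    by rewrite CE_degE ni => s sn; rewrite truncE -eqz_nat (negPf sn).
  move: b bi {bX}; apply: ext_deg_ind; first by rewrite !linear0.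
  move=> c s b [sn] IH; rewrite !linearP/= IH !ext_pairing_prod truncE.
  by rewrite sn eqxx.
- move=> X; rewrite MC_CE => -[/= dX X2]; split.
    by rewrite /twisted_d [dgla_d X]dX addr0.
  have [delta deltaP] := ext_codifferential g; exists delta; split.
  + by move=> i Y b _ _; rewrite /twisted_d addr0 deltaP.
  + exact: ext_is_BV.
  + have rhoE (a : ext g) s : ext_act (repr a) X s = ext_pairing X (a * ext_prod s).
      by rewrite ext_pairingM ext_pairing_prod.
    pose rho (a : ext g) : altform g := ext_act (repr a) X.
    have rho_linear : linear rho.
      move=> c a b; apply: altformP => s.
      by rewrite altform_linear !rhoE mulrDl -scalerAl linearP.
    pose rhoL := GRing.isLinear.Build K (exterior_algebra g) (CE_dgla g) *:%R
      rho rho_linear.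
    exists 0, (HB.pack_for {linear exterior_algebra g -> CE_dgla g} rho rhoL).
    split=> [a a1|a b _ _|a b _ _]; last by rewrite scale0r.
      suff : forall s : seq g, (size s)%:Z != 0 + 1 -> rho a s = 0 by [].
      move=> s s1; rewrite rhoE.
      (* [X] lives in arity 2, so after one argument taken from [a] only lists [s] of length 1
         contribute. *)
      move: a a1; apply: ext_deg_ind; first by rewrite mul0r linear0.
      move=> c t a t1 aX; rewrite mulrDl -scalerAl linearP/= aX addr0 -big_cat.
      rewrite ext_pairing_prod X2 ?mulr0// size_cat.
      by case: t1 => ->; rewrite add1n eqSS -eqz_nat.
    exact: ext_pairingM.
Qed.

(** The right-hand side is the central component of the Jacobi expression of [extension_bracket],
    which identifies cocycles with Lie brackets. *)
Lemma CE_d3 X u v w : CE_d X [:: u; v; w] =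
  X [:: u; lie_br v w] + X [:: v; lie_br w u] + X [:: w; lie_br u v].
Proof.
rewrite CE_dE /= !big_ord_recr !big_ord0 /= /del /= !add0r !add0n addn2.
rewrite ![X [:: _; lie_br _ _]]altform_swap.
rewrite (lie_brC w u) altform_consN.
by rewrite !exprS expr0; ring.
Qed.

Lemma extension_bracket_central_extension X : cocycles2 g X ->
  is_central_extension g (extension_bracket g X).
Proof.
move=> [/= dX X2]; have [[brl brr] br0 jac] := lie_brP g.
have /asboolP[X1 Xalt] := altform_valP X.
have br0l v : lie_br (0 : g) v = 0 by exact: (linear_fun0 (brl v)).
split; first split.
- split=> [y|x] k u v; rewrite /extension_bracket /=.
    by rewrite brl (X1 [::]).
  by rewrite brr (X1 [:: x.1]).
- by move=> x; rewrite /extension_bracket br0 (Xalt [::] [::] [::]).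
- move=> x y z; apply/eqP; rewrite xpair_eqE /= jac eqxx /=.
  by rewrite -CE_d3 dX.
- by [].
- by move=> t y; rewrite /extension_bracket /= br0l altform_cons0.
Qed.

(** The cocycle of an extension, read off along the linear section sending [u] to [(u, 0)] and set
    to 0 outside arity 2. *)
Lemma cocycle_alternating (br : g * K^o -> g * K^o -> g * K^o) :
  is_central_extension g br ->
  (fun s => if s is [:: u; v] then (br (u, 0) (v, 0)).2 else 0 : K^o)
    \in alternating (g:=g).
Proof.
move=> [[[brl brr] br0 _] _ _]; apply/asboolP; split=> [s1 s2 c u v|s1 s2 s3 u].
  have uvE : (c *: u + v, 0) = c *: (u, 0) + (v, 0) :> g * K^o.
    by apply/eqP; rewrite xpair_eqE /= scaler0 addr0 !eqxx.
  case: s1 => [|x [|y [|z s1]]] /=; case: s2 => [|w [|w' s2]] /=;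
    rewrite ?mulr0 ?addr0// uvE ?brl ?brr//.
by case: s1 => [|x [|y [|z s1]]] /=; case: s2 => [|w [|w' s2]] //=;
  case: s3 => [|? ?] //=; rewrite br0.
Qed.

Lemma extension_bracket_bij : set_bij (cocycles2 g) (is_central_extension g)
  (extension_bracket g).
Proof.
split.
- by move=> X; exact: extension_bracket_central_extension.
- move=> X Y; rewrite !inE => -[_ X2] [_ Y2] XY; apply: altformP => s.
  have [|s2] := eqVneq (size s) 2%N; last by rewrite X2// Y2.
  case: s => [|u [|v []]]// _.
  by have /(congr1 (fun br => (br (u, 0) (v, 0)).2)) := XY.
- move=> br brP; pose X := AltForm (cocycle_alternating brP).
  have [[[brl brr] br0 jac] br1 brc] := brP.
  have brcr (t : K^o) (y : g * K^o) : br y (0, t) = 0.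
    have := br0 (1 *: (0, t) + y).
    by rewrite brl !brr /= !br0 !brc !(scaler0, add0r, addr0) scale1r.
  have XE : extension_bracket g X = br.
    apply/funext => x; apply/funext => y; rewrite /extension_bracket -br1.
    have split0 (z : g * K^o) : z = 1 *: (z.1, 0) + (0, z.2).
      by rewrite scale1r; case: z => u t; congr (_, _); rewrite /= ?addr0 ?add0r.
    have -> : br x y = br (x.1, 0) (y.1, 0).
      by rewrite {1}[x]split0 {1}[y]split0 brl brc addr0 brr brcr addr0 /= !scale1r.
    by rewrite [RHS]surjective_pairing.
  exists X => //; split=> /=; last by case=> [|u [|v [|w s]]].
  apply: altformP => s.
  have [|s3] := eqVneq (size s) 3%N.
    case: s => [|u [|v [|w []]]]// _; rewrite CE_d3.
    have := jac (u, 0) (v, 0) (w, 0); rewrite -XE.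
    by move=> /(congr1 snd).
  (* Each term evaluates [X] on one argument fewer than [s] has, and [X] vanishes outside arity 2;
     so only arity 3, settled by the Jacobi identity, could contribute. *)
  rewrite CE_dE big1// => j _; rewrite big1// => i _.
  have := size_del2 (ltn_ord i) (ltn_ord j).
  case: (del i _) => [|a [|b t]] /=; rewrite ?mulr0// => s3'.
  by rewrite -s3' in s3.
Qed.

End CentralExtensions.

Theorem proposition10p1 (K : fieldType) (hK : real_or_complex K)
    (g : lieAlgebra K) :
  [/\ is_MCP (CE_dgla g) (exterior_algebra g) ext_pairing,
      MC (CE_dgla g) = cocycles2 g &
      set_bij (MC (CE_dgla g)) (is_central_extension g)
              (extension_bracket g)].
Proof.
rewrite MC_CE; split=> //; [exact: CE_MCP|exact: extension_bracket_bij].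
Qed.
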